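(* For every $n\geq1$, let $X_n$ be the variety over $\mathbb C$ and $\alpha_n,\beta_n\in X_n(\mathbb C)$ the points defined in the context. Then $[\alpha_n]_n$ and $[\beta_n]_n$ are $\mathbb A^1$-homotopic in $\mathcal S^n(X_n)$ (as sections over $\mathrm{Spec}\,\mathbb C$).
   Context: Sheaves: Let $Sm/\mathbb C$ be the category of smooth schemes of finite type over $\mathbb C$ with the Nisnevich topology. A (possibly singular) scheme $X$ over $\mathbb C$ is viewed as the sheaf of sets $U\mapsto \mathrm{Hom}_{\mathbb C}(U,X)$ on $Sm/\mathbb C$. For a Nisnevich sheaf of sets $\mathcal F$ and $U\in Sm/\mathbb C$, two sections $x_0,x_1\in\mathcal F(U)$ are $\mathbb A^1$-homotopic if there is $h\in\mathcal F(\mathbb A^1_{\mathbb C}\times U)$ with $h(0)=x_0$, $h(1)=x_1$, where $h(t)$ is the pullback of $h$ along $U\to\mathbb A^1_{\mathbb C}\times U$, $u\mapsto(t,u)$. $\mathcal S(\mathcal F)$ is the Nisnevich sheafification of the presheaf $U\mapsto\mathcal F(U)/\sim$, where $\sim$ is the equivalence relation generated by $\mathbb A^1$-homotopy; $\mathcal S^0(\mathcal F)=\mathcal F$ and $\mathcal S^{m+1}(\mathcal F)=\mathcal S(\mathcal S^m(\mathcal F))$. For $x\in\mathcal F(U)$, $[x]_j$ denotes the image of $x$ in $\mathcal S^j(\mathcal F)(U)$. Varieties: Fix $\lambda_1,\lambda_2,\lambda_3\in\mathbb C\setminus\{0\}$, put $f(x)=(x-\lambda_1)(x-\lambda_2)(x-\lambda_3)$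 and let $\lambda=\sqrt{-\lambda_1\lambda_2\lambda_3}$ be a fixed square root. Let $X_0=\mathbb A^1_{\mathbb C}$ and $X_1=\mathrm{Spec}\,\mathbb C[x_0,x_1,y_1]/\langle y_1^2-x_0^2f(x_1)\rangle\setminus\{(0,0,0)\}$. Let $\phi_1,\psi_1:X_1\to X_0$ be the projections to the $x_0$-coordinate and the $x_1$-coordinate respectively. For $n\ge2$, inductively let $X_n=X_{n-1}\times_{\psi_{n-1},X_{n-2},\phi_{n-1}}X_{n-1}$, with first projection $\phi_n:X_n\to X_{n-1}$ and second projection $\psi_n:X_n\to X_{n-1}$. Equivalently, $X_n$ is the $n$-fold fiber product $X_1\times_{\psi_1,\mathbb A^1_{\mathbb C},\phi_1}X_1\times\cdots\times_{\psi_1,\mathbb A^1_{\mathbb C},\phi_1}X_1$, with $\phi_n$ and $\psi_n$ the projections to the first and last $n-1$ factors respectively (for $n\ge 2$). Points: $\alpha_1=(1,0,\lambda)$ and $\beta_1=(0,1,0)$ in $X_1(\mathbb C)$. For $n\ge2$, in the $n$-fold fiber product description, $\alpha_n=(\alpha_1,\beta_1,\alpha_1,\dots)$ and $\beta_n=(\beta_1,\alpha_1,\beta_1,\dots)$ are the alternating sequences of length $n$ in $\alpha_1,\beta_1$ starting with $\alpha_1$, respectively $\beta_1$; these are well defined since $\psi_1(\alpha_1)=\phi_1(\beta_1)=0$ and $\psi_1(\beta_1)=\phi_1(\alpha_1)=1$. *)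

(* Defs.v *)
From HB Require Import structures.
From Stdlib Require Import Relation_Operators.
From mathcomp Require Import all_boot all_order all_algebra.
From mathcomp Require Import ring.
From mathcomp Require Import boolp.
From mathcomp Require Export reals complex.

Set Implicit Arguments.
Unset Strict Implicit.
Unset Printing Implicit Defensive.

Import GRing.Theory.
Local Open Scope ring_scope.

(* Schemes over a field k are handled through their functors of points
   (Demazure-Gabriel, Groupes algebriques, I.1): a k-scheme is a functor from
   commutative k-algebras to sets which is a sheaf for the Zariski topology and
   is covered by open affine subfunctors; a morphism of k-schemes is a natural
   transformation. *)

(* The zero ring is allowed, which comAlgType excludes. *)
Record alg (k : fieldType) := Alg {
  alg_ring :> comPzRingType;
  alg_in : {rmorphism k -> alg_ring} }.

Record algHom (k : fieldType) (A B : alg k) := AlgHom {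
  hom_fun :> {rmorphism A -> B};
  homP : forall c, hom_fun (alg_in A c) = alg_in B c }.

Section AlgebraCategory.
Variable k : fieldType.
Implicit Types A B C : alg k.

Lemma algHom_eq A B (f g : algHom A B) : f =1 g -> f = g.
Proof.
case: f g => [f fP] [g gP] /= fg.
have e : f = g.
  case: f g fg {fP gP} => [f [[fa] [fm]]] [g [[ga] [gm]]] /= /funext fg.
  case: _ / fg in ga gm *.
  by rewrite (Prop_irrelevance ga fa) (Prop_irrelevance gm fm).
by case: _ / e in gP *; rewrite (Prop_irrelevance gP fP).
Qed.

Definition idHom A : algHom A A := @AlgHom k A A idfun (fun=> erefl).

Lemma compHom_subproof A B C (g : algHom B C) (f : algHom A B) c :
  (g \o f) (alg_in A c) = alg_in C c.
Proof. by rewrite /= !homP. Qed.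

Definition compHom A B C (g : algHom B C) (f : algHom A B) : algHom A C :=
  @AlgHom k A C (g \o f) (compHom_subproof g f).

Lemma compHomI A B (f : algHom A B) : compHom f (idHom A) = f.
Proof. exact: algHom_eq. Qed.

Lemma compIHom A B (f : algHom A B) : compHom (idHom B) f = f.
Proof. exact: algHom_eq. Qed.

Lemma compHomA A B C D (h : algHom C D) (g : algHom B C) (f : algHom A B) :
  compHom h (compHom g f) = compHom (compHom h g) f.
Proof. exact: algHom_eq. Qed.

Definition baseAlg : alg k := @Alg k k idfun.

Definition strHom A : algHom baseAlg A := @AlgHom k baseAlg A (alg_in A) (fun=> erefl).

Lemma strHom_uniq A (f : algHom baseAlg A) : f = strHom A.
Proof. by apply: algHom_eq => c; exact: (homP f c). Qed.

Definition fg_alg A := exists s : seq A,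
  forall P : A -> Prop,
    (forall c, P (alg_in A c)) -> (forall x y, P x -> P y -> P (x + y)) ->
    (forall x y, P x -> P y -> P (x * y)) -> (forall x, x \in s -> P x) ->
  forall x, P x.

Definition unit_ideal A (E : A -> Prop) :=
  exists n (e c : 'I_n -> A), (forall i, E (e i)) /\ \sum_i c i * e i = 1.

(* l exhibits B as the localization A[1/a] *)
Definition is_localization A B (l : algHom A B) (a : A) :=
  [/\ exists u, l a * u = 1,
      forall b, exists x n, b * l a ^+ n = l x
    & forall x, l x = 0 -> exists n, a ^+ n * x = 0].

End AlgebraCategory.

Arguments idHom {k A}.

Record kfun (k : fieldType) := KFun {
  pts :> alg k -> Type;
  pmap : forall A B, algHom A B -> pts A -> pts B;
  pmap_id : forall A x, pmap (@idHom k A) x = x;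
  pmap_comp : forall A B C (g : algHom B C) (f : algHom A B) x,
    pmap (compHom g f) x = pmap g (pmap f x) }.

Record knat (k : fieldType) (X Y : kfun k) := KNat {
  nat_fun :> forall A, X A -> Y A;
  natP : forall A B (f : algHom A B) x,
    nat_fun (pmap f x) = pmap f (nat_fun x) }.

Section Schemes.
Variable k : fieldType.
Implicit Types (A B C : alg k) (X Y Z : kfun k).

Lemma knat_eq X Y (f g : knat X Y) : (forall A x, f A x = g A x) -> f = g.
Proof.
case: f g => [f fP] [g gP] /= fg.
have e : f = g.
  by apply: functional_extensionality_dep => A; apply: funext => x.
by case: _ / e in gP *; rewrite (Prop_irrelevance gP fP).
Qed.

Definition idNat {X} : knat X X := @KNat k X X (fun A x => x) (fun A B f x => erefl).

Lemma compNat_subproof X Y Z (g : knat Y Z) (f : knat X Y) A B (h : algHom A B) x :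
  g _ (f _ (pmap h x)) = pmap h (g _ (f _ x)).
Proof. by rewrite !natP. Qed.

Definition compNat X Y Z (g : knat Y Z) (f : knat X Y) : knat X Z :=
  @KNat k X Z (fun A x => g A (f A x)) (@compNat_subproof X Y Z g f).

Lemma compNatI X Y (f : knat X Y) : compNat f idNat = f.
Proof. exact: knat_eq. Qed.

Lemma compINat X Y (f : knat X Y) : compNat idNat f = f.
Proof. exact: knat_eq. Qed.

Lemma compNatA X Y Z T (h : knat Z T) (g : knat Y Z) (f : knat X Y) :
  compNat h (compNat g f) = compNat (compNat h g) f.
Proof. exact: knat_eq. Qed.

Definition Spec B : kfun k :=
  @KFun k (algHom B) (fun A C g f => compHom g f)
    (fun A f => compIHom f) (fun A C D g f x => esym (compHomA g f x)).

Definition A1 : kfun k :=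
  @KFun k (fun A => A) (fun A B f x => f x) (fun A x => erefl)
    (fun A B C g f x => erefl).

Lemma kprod_id X Y A (x : X A * Y A) :
  (pmap (@idHom k A) x.1, pmap (@idHom k A) x.2) = x.
Proof. by rewrite !pmap_id; case: x. Qed.

Lemma kprod_comp X Y A B C (g : algHom B C) (f : algHom A B) (x : X A * Y A) :
  (pmap (compHom g f) x.1, pmap (compHom g f) x.2)
    = (pmap g (pmap f x.1), pmap g (pmap f x.2)).
Proof. by rewrite !pmap_comp. Qed.

Definition kprod X Y : kfun k :=
  @KFun k (fun A => (X A * Y A)%type)
    (fun A B f x => (pmap f x.1, pmap f x.2))
    (@kprod_id X Y) (@kprod_comp X Y).

(* The A_ i cover Spec A by principal opens, with pairwise intersections
   A__ i j. *)
Definition zariski_sheaf X :=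
  forall A n (a : 'I_n -> A), (exists c : 'I_n -> A, \sum_i c i * a i = 1) ->
  forall (A_ : 'I_n -> alg k) (l : forall i, algHom A (A_ i))
    (A__ : 'I_n -> 'I_n -> alg k)
    (r1 : forall i j, algHom (A_ i) (A__ i j))
    (r2 : forall i j, algHom (A_ j) (A__ i j)),
    (forall i, is_localization (l i) (a i)) ->
    (forall i j, is_localization (compHom (r1 i j) (l i)) (a i * a j)) ->
    (forall i j, compHom (r1 i j) (l i) = compHom (r2 i j) (l j)) ->
  forall s : forall i, X (A_ i),
    (forall i j, pmap (r1 i j) (s i) = pmap (r2 i j) (s j)) ->
  exists! x : X A, forall i, pmap (l i) x = s i.

(* Demazure-Gabriel I.1.3.6: for every x : Spec A -> X, the preimage of the
   subfunctor P is the open subset of Spec A where the ideal generated by some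
   E does not vanish. *)
Definition open_subfun X (P : forall A, X A -> Prop) :=
  forall A (x : X A), exists E : A -> Prop,
  forall B (f : algHom A B),
    P B (pmap f x) <-> unit_ideal (fun b => exists2 e, E e & b = f e).

Definition open_immersion X Y (j : knat X Y) :=
  (forall A, injective (j A)) /\
  open_subfun (fun A (y : Y A) => exists x, j A x = y).

(* Open subfunctors cover X when they do so on points over fields. *)
Definition scheme_of_finite_type X :=
  zariski_sheaf X /\
  exists n (B : 'I_n -> alg k) (j : forall i, knat (Spec (B i)) X),
    [/\ forall i, fg_alg (B i),
        forall i, open_immersion (j i)
      & forall (K : fieldType) (iota : {rmorphism k -> K}) (x : X (Alg iota)),
          exists i y, j i _ y = x].

Definition square_zero_ext A B (p : algHom A B) :=
  (forall b, exists a, p a = b) /\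
  (forall a a', p a = 0 -> p a' = 0 -> a * a' = 0).

(* For schemes of finite type over a field, where finite presentation is
   automatic, smooth = formally smooth. *)
Definition formally_smooth X :=
  forall A B (p : algHom A B), square_zero_ext p ->
  forall x : X B, exists y : X A, pmap p y = x.

Definition formally_etale X Y (f : knat X Y) :=
  forall A B (p : algHom A B), square_zero_ext p ->
  forall (x : X B) (y : Y A), f B x = pmap p y ->
  exists! z : X A, pmap p z = x /\ f A z = y.

End Schemes.

Arguments idNat {k X}.

Record Sm (k : fieldType) := MkSm {
  sm_fun :> kfun k;
  sm_scheme : scheme_of_finite_type sm_fun;
  sm_smooth : formally_smooth sm_fun }.

Section SmoothExamples.
Variable k : fieldType.
Implicit Types (A B C : alg k) (X Y : kfun k).


Lemma ideal_powers (R : comPzRingType) (P : R -> Prop) N :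
  (forall x y, P x -> P y -> P (x + y)) -> (forall x y, P y -> P (x * y)) ->
  forall n (a c : 'I_n -> R) r, P r -> (forall i, P (a i ^+ N)) ->
  \sum_i c i * a i + r = 1 -> P 1.
Proof.
move=> PD PM; elim=> [|n IH] a c r Pr Pa; first by rewrite big_ord0 add0r => <-.
rewrite big_ord_recl -addrA; set u := c _ * _; set y := _ + r => uy.
have [z uyN] : exists z, (u + y) ^+ N = u ^+ N + y * z.
  elim: (N) => [|m [z e]]; first by exists 0; rewrite mulr0 addr0 !expr0.
  exists (u ^+ m + (u + y) * z).
  by rewrite exprS e exprS; ring.
move: uyN; rewrite uy expr1n => e.
apply: (IH (fun i => a (lift ord0 i)) (fun i => z * c (lift ord0 i))
          (u ^+ N + z * r)) => //.
  by apply: PD; [rewrite /u exprMn; apply: PM | apply: PM].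
under eq_bigr do rewrite -mulrA; rewrite -mulr_sumr [RHS]e /y; ring.
Qed.

Lemma unit_idealX (R : comPzRingType) n (a : 'I_n -> R) N :
  (exists c, \sum_i c i * a i = 1) -> exists c, \sum_i c i * a i ^+ N = 1.
Proof.
move=> [c c1].
apply: (@ideal_powers _ (fun x => exists c, \sum_i c i * a i ^+ N = x) N
          _ _ n a c 0).
- move=> x y [d <-] [e <-]; exists (fun i => d i + e i).
  by rewrite -big_split; apply: eq_bigr => i _; rewrite mulrDl.
- move=> x y [d <-]; exists (fun i => x * d i).
  by rewrite mulr_sumr; apply: eq_bigr => i _; rewrite mulrA.
- by exists (fun=> 0); rewrite big1 // => i _; rewrite mul0r.
- move=> i; exists (fun j => (j == i)%:R).
  rewrite (bigD1 i) //= eqxx mul1r big1 ?addr0 // => j /negPf ->.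
  by rewrite mul0r.
- by rewrite addr0.
Qed.

Lemma unif_exp n (Q : 'I_n -> nat -> Prop) :
  (forall i m p, (m <= p)%N -> Q i m -> Q i p) ->
  (forall i, exists m, Q i m) -> exists m, forall i, Q i m.
Proof.
move=> Qm /choice[m mP]; exists (\max_i m i)%N => i.
by apply: Qm (mP i); apply: leq_bigmax.
Qed.

Lemma A1_sheaf : zariski_sheaf (A1 k).
Proof.
move=> A n a a1 A_ l A__ r1 r2 Ll Lr r12 s s12.
have uniq0 x : (forall i, l i x = 0) -> x = 0.
  move=> lx0.
  have [m mP] : exists m, forall i, a i ^+ m * x = 0.
    apply: unif_exp => [i m p mp e|i]; last first.
      by have [_ _ /(_ x (lx0 i))] := Ll i.
    by rewrite -(subnK mp) exprD -mulrA e mulr0.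
  have [c c1] := unit_idealX m a1.
  rewrite -[x]mul1r -c1 mulr_suml big1 // => i _.
  by rewrite -mulrA mP mulr0.
have [m mP] : exists m, forall i, exists x, s i * l i (a i) ^+ m = l i x.
  apply: unif_exp => [i m p mp [x e]|i].
    exists (x * a i ^+ (p - m)).
    by rewrite rmorphM rmorphXn -e -mulrA -exprD subnKC.
  by have [_ /(_ (s i)) [x [m e]] _] := Ll i; exists m, x.
have [x xP] := choice mP.
have [q qP] : exists q, forall i, forall j,
    (a i * a j) ^+ q * (x i * a j ^+ m - x j * a i ^+ m) = 0.
  apply: unif_exp => [i u p up e j|i].
    by rewrite -(subnK up) exprD -mulrA e mulr0.
  apply: unif_exp => [j u p up e|j].
    by rewrite -(subnK up) exprD -mulrA e mulr0.
  have [_ _ L0] := Lr i j; apply: L0.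
  rewrite rmorphB !rmorphM !rmorphXn /=.
  have rl z : r1 i j (l i z) = r2 i j (l j z).
    by have /(congr1 (fun f : algHom _ _ => f z)) := r12 i j.
  rewrite -xP (rl (a j)) (rl (x j)) -xP !rmorphM !rmorphXn -rl /=.
  have /= -> := s12 i j.
  by rewrite mulrAC subrr.
have [c c1] := unit_idealX (q + m) a1.
have sP j : l j (\sum_i c i * (x i * a i ^+ q)) = s j.
  have [[u uP] _ _] := Ll j.
  have uNP : l j (a j) ^+ (q + m) * u ^+ (q + m) = 1 by rewrite -exprMn uP expr1n.
  rewrite -[RHS]mulr1 -[LHS]mulr1 -uNP !mulrA; congr (_ * _).
  rewrite exprD (mulrC (_ ^+ q)) (mulrA (s j)) xP -!rmorphXn -!rmorphM.
  congr (l j _); rewrite -[RHS]mulr1 -c1 mulr_suml mulr_sumr.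
  apply: eq_bigr => i _.
  have /eqP := qP i j; rewrite mulrBr subr_eq0 => /eqP e.
  move: e; rewrite exprMn exprD => e.
  transitivity (c i * (a i ^+ q * a j ^+ q * (x i * a j ^+ m))); first by ring.
  by rewrite e; ring.
exists (\sum_i c i * (x i * a i ^+ q)); split=> // y yP.
apply/eqP; rewrite -subr_eq0; apply/eqP; apply: uniq0 => i.
by have /= := yP i; rewrite rmorphB /= => ->; rewrite sP subrr.
Qed.

Lemma mk_rmorphism (R S : pzRingType) (f : R -> S) :
  (forall x y, f (x - y) = f x - f y) -> f 1 = 1 ->
  (forall x y, f (x * y) = f x * f y) -> exists g : {rmorphism R -> S}, g =1 f.
Proof.
move=> fB f1 fM.
pose g : {rmorphism R -> S} := HB.pack f
  (GRing.isZmodMorphism.Build R S f fB) (GRing.isMonoidMorphism.Build R S f (f1, fM)).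
by exists g.
Qed.

Lemma Spec_sheaf B : zariski_sheaf (Spec B).
Proof.
move=> A n a a1 A_ l A__ r1 r2 Ll Lr r12 s s12.
have loc := A1_sheaf a1 Ll Lr r12.
have sep x y : (forall i, l i x = l i y) -> x = y.
  move=> lxy; have [|z [_ zU]] := loc (fun i => l i x).
    by move=> i j /=; have /(congr1 (fun f : algHom _ _ => f x)) := r12 i j.
  by rewrite -(zU x) //; apply: zU => i /=; rewrite lxy.
have /choice[f fP] : forall b, exists x, forall i, l i x = s i b.
  move=> b; have [|z [zP _]] := loc (fun i => s i b); last by exists z.
  by move=> i j; have /(congr1 (fun f : algHom _ _ => f b)) := s12 i j.
have [g gf] : exists g : {rmorphism B -> A}, g =1 f.
  apply: mk_rmorphism => [x y||x y]; apply: sep => i.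
  - by rewrite rmorphB !fP rmorphB.
  - by rewrite fP !rmorph1.
  - by rewrite rmorphM !fP rmorphM.
have gP c : g (alg_in B c) = alg_in A c.
  by apply: sep => i; rewrite gf fP !homP.
exists (AlgHom gP); split=> [i|h hP].
  by apply: algHom_eq => b /=; rewrite gf fP.
apply: algHom_eq => b; apply: sep => i /=.
by have /(congr1 (fun f : algHom _ _ => f b)) /= -> := hP i; rewrite gf fP.
Qed.

Lemma kprod_sheaf X Y :
  zariski_sheaf X -> zariski_sheaf Y -> zariski_sheaf (kprod X Y).
Proof.
move=> HX HY A n a a1 A_ l A__ r1 r2 Ll Lr r12 s s12.
have [i j|x [xP xU]] := HX _ _ _ a1 _ _ _ _ _ Ll Lr r12 (fun i => (s i).1).
  by have /(congr1 fst) := s12 i j.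
have [i j|y [yP yU]] := HY _ _ _ a1 _ _ _ _ _ Ll Lr r12 (fun i => (s i).2).
  by have /(congr1 snd) := s12 i j.
exists (x, y); split=> [i|[x' y'] xyP] /=.
  by rewrite xP yP; case: (s i).
by congr (_, _); [apply: xU | apply: yU] => i; rewrite -xyP.
Qed.

Lemma horner_ext (R S : comNzRingType) (g : {rmorphism R -> S}) (a : S) :
  exists h : {rmorphism {poly R} -> S}, (forall c, h c%:P = g c) /\ h 'X = a.
Proof.
have cg : commr_rmorph g a by move=> x; apply: mulrC.
exists (horner_morph cg); split=> [c|]; [exact: horner_morphC | exact: horner_morphX].
Qed.

Lemma poly_alg B : exists (P : alg k) (e : algHom B P) (T : P),
  (forall A (g : algHom B A) (a : A), exists! h : algHom P A,
      compHom h e = g /\ h T = a) /\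
  (forall Q : P -> Prop, (forall b, Q (e b)) -> Q T ->
     (forall x y, Q x -> Q y -> Q (x + y)) ->
     (forall x y, Q x -> Q y -> Q (x * y)) -> forall x, Q x).
Proof.
have triv (R S : comPzRingType) (g : {rmorphism R -> S}) : 1 = 0 :> R ->
    forall x : S, x = 0.
  by move=> R10 x; rewrite -[x]mulr1 -(rmorph1 g) R10 rmorph0 mulr0.
have [B10|B1] := eqVneq (1 : B) 0.
  exists B, idHom, 0; split=> [A g a|Q Qe _ _ _ x]; last exact: (Qe x).
  have A0 := triv _ _ g B10.
  exists g; split=> [|h [<- _]]; last by rewrite compHomI.
  by rewrite compHomI (A0 a) rmorph0.
pose B' : comNzRingType := HB.pack (alg_ring B)
  (GRing.PzSemiRing_isNonZero.Build (alg_ring B) B1).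
pose i0 : {rmorphism k -> B'} := alg_in B.
pose P := @Alg k {poly B'} (polyC \o i0).
pose e0 : {rmorphism B -> P} := (polyC : {rmorphism B' -> {poly B'}}).
have e0P c : e0 (alg_in B c) = alg_in P c by [].
have gen (Q : P -> Prop) : (forall b, Q (e0 b)) -> Q 'X ->
     (forall x y, Q x -> Q y -> Q (x + y)) ->
     (forall x y, Q x -> Q y -> Q (x * y)) -> forall x, Q x.
  move=> Qe QX QD QM; elim/poly_ind => [|p c Qp]; first by rewrite -polyC0; exact: (Qe 0).
  by apply: QD (Qe c); apply: QM.
exists P, (AlgHom e0P), 'X; split=> // A g a.
suff [h [he hX]] : exists h : algHom P A, compHom h (AlgHom e0P) = g /\ h 'X = a.
  exists h; split=> // h' [h'e h'X]; apply: algHom_eq; apply: gen.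
  - by move=> b; rewrite -[h _]/(compHom h (AlgHom e0P) b) he -h'e.
  - by rewrite hX h'X.
  - by move=> x y; rewrite !rmorphD => -> ->.
  - by move=> x y; rewrite !rmorphM => -> ->.
have [A10|A1n0] := eqVneq (1 : A) 0.
  have A0 := triv _ _ (idfun : {rmorphism A -> A}) A10.
  have [h _] : exists h : {rmorphism P -> A}, h =1 fun=> 0.
    by apply: mk_rmorphism => *; rewrite ?subr0 ?mulr0 ?A10.
  have hP c : h (alg_in P c) = alg_in A c by rewrite [LHS]A0 [RHS]A0.
  exists (AlgHom hP); split; last by rewrite [LHS]A0 [RHS]A0.
  by apply: algHom_eq => b; rewrite [LHS]A0 [RHS]A0.
pose A' : comNzRingType := HB.pack (alg_ring A)
  (GRing.PzSemiRing_isNonZero.Build (alg_ring A) A1n0).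
pose g' : {rmorphism B' -> A'} := hom_fun g.
have [h0 [h0C h0X]] := horner_ext g' a.
pose h : {rmorphism P -> A} := h0.
have hP c : h (alg_in P c) = alg_in A c by rewrite -(homP g); apply: h0C.
exists (AlgHom hP); split; last exact: h0X.
by apply: algHom_eq => b; apply: h0C.
Qed.

Lemma unit_ideal1 A (E : A -> Prop) : E 1 -> unit_ideal E.
Proof.
by exists 1%N, (fun=> 1), (fun=> 1); split=> //; rewrite big_ord1 mulr1.
Qed.

Lemma Spec_base_scheme : scheme_of_finite_type (Spec (baseAlg k)).
Proof.
split; first exact: Spec_sheaf.
exists 1%N, (fun=> baseAlg k), (fun=> idNat); split.
- by move=> i; exists [::] => P Pc _ _ _; exact: Pc.
- move=> i; split=> [A x y //|A x]; exists (fun e => e = 1) => B f.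
  split=> _; last by exists (pmap f x).
  by apply: unit_ideal1; exists 1; rewrite ?rmorph1.
- by move=> K iota x; exists ord0, x.
Qed.

Lemma Spec_base_smooth : formally_smooth (Spec (baseAlg k)).
Proof.
by move=> A B p _ x; exists (strHom A); rewrite [x]strHom_uniq; apply: strHom_uniq.
Qed.

Lemma A1_affine X B (j : knat (Spec B) X) : fg_alg B -> open_immersion j ->
  exists PJ : {P : alg k & knat (Spec P) (kprod (A1 k) X)},
    [/\ fg_alg (projT1 PJ), open_immersion (projT2 PJ)
      & forall A (t : A) (y : Spec B A), exists z, projT2 PJ A z = (t, j A y)].
Proof.
move=> [s sB] [jinj jop]; have [P [e [T [univ gen]]]] := poly_alg B.
have nt A C (f : algHom A C) (h : Spec P A) :
     ((pmap f h : Spec P C) T, j C (compHom (pmap f h) e))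
     = pmap f ((h T, j A (compHom h e)) : kprod (A1 k) X A).
  by rewrite /= -natP /= compHomA.
pose J := @KNat k (Spec P) (kprod (A1 k) X) _ nt.
have Jsurj A (t : A) (y : Spec B A) : exists z, J A z = (t, j A y).
  by have [h [[he hT] _]] := univ A y t; exists h; rewrite /= hT he.
exists (existT _ P J); split=> //=.
- exists (T :: map e s) => Q Qc QD QM Qs; apply: gen => //.
    apply: sB => [c|x y|x y|x xs]; rewrite ?homP ?rmorphD ?rmorphM //.
    - exact: QD.
    - exact: QM.
    - by apply: Qs; rewrite inE map_f ?orbT.
  by apply: Qs; rewrite inE eqxx.
- split=> [A h h' [hT /jinj he]|A [t x]].
    by have [h0 [_ U]] := univ A (compHom h e) (h T); rewrite -(U h) // -(U h').
  have [E EP] := jop A x; exists E => C f; rewrite -EP; split.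
    by move=> [h [_ hx]]; exists (compHom h e).
  by move=> [y yx]; have [z zP] := Jsurj C (f t) y; exists z; rewrite zP yx.
Qed.

Lemma A1_prod_scheme X :
  scheme_of_finite_type X -> scheme_of_finite_type (kprod (A1 k) X).
Proof.
move=> [shX [n [B [j [Bfg jo jc]]]]]; split.
  by apply: kprod_sheaf => //; apply: A1_sheaf.
have /choice[PJ PJP] := fun i => A1_affine (Bfg i) (jo i).
exists n, (fun i => projT1 (PJ i)), (fun i => projT2 (PJ i)); split.
- by move=> i; have [] := PJP i.
- by move=> i; have [] := PJP i.
move=> K iota [t x]; have [i [y yx]] := jc K iota x.
by have [_ _ /(_ _ t y) [z zP]] := PJP i; exists i, z; rewrite zP yx.
Qed.

Lemma A1_prod_smooth X : formally_smooth X -> formally_smooth (kprod (A1 k) X).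
Proof.
move=> Xs A B p pP [t x]; have [y yx] := Xs A B p pP x.
by have [/(_ t) [u ut] _] := pP; exists (u, y); rewrite /= yx ut.
Qed.

Definition SpecBase : Sm k := MkSm Spec_base_scheme Spec_base_smooth.

Definition A1x (U : Sm k) : Sm k :=
  MkSm (A1_prod_scheme (sm_scheme U)) (A1_prod_smooth (@sm_smooth k U)).

Lemma at_pt_subproof (t : k) (U : Sm k) A B (f : algHom A B) (u : U A) :
  (alg_in B t, pmap f u) = (f (alg_in A t), pmap f u).
Proof. by rewrite homP. Qed.

(* U -> A^1 x U, u |-> (t, u) *)
Definition at_pt (t : k) (U : Sm k) : knat U (A1x U) :=
  @KNat k U (A1x U) (fun A u => (alg_in A t, u)) (@at_pt_subproof t U).

Lemma A1x_map_subproof (U V : Sm k) (g : knat V U) A B (f : algHom A B)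
  (v : A1x V A) : (f v.1, g B (pmap f v.2)) = (f v.1, pmap f (g A v.2)).
Proof. by rewrite natP. Qed.

Definition A1x_map (U V : Sm k) (g : knat V U) : knat (A1x V) (A1x U) :=
  @KNat k (A1x V) (A1x U) (fun A v => (v.1, g A v.2)) (@A1x_map_subproof U V g).

Lemma at_pt_nat t (U V : Sm k) (g : knat V U) :
  compNat (A1x_map g) (at_pt t V) = compNat (at_pt t U) g.
Proof. exact: knat_eq. Qed.

End SmoothExamples.

Section NisnevichTopology.
Variable k : fieldType.
Implicit Types U V W : Sm k.

Record sieve U := Sieve {
  in_sieve :> forall V, knat V U -> Prop;
  sieveP : forall V W (f : knat V U) (g : knat W V),
    in_sieve f -> in_sieve (compNat f g) }.

Lemma pull_sieve_subproof U V (g : knat V U) (R : sieve U) W W'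
  (f : knat W V) (h : knat W' W) :
  R W (compNat g f) -> R W' (compNat g (compNat f h)).
Proof. by rewrite compNatA; apply: sieveP. Qed.

Definition pull_sieve U V (g : knat V U) (R : sieve U) : sieve V :=
  @Sieve V (fun W f => R W (compNat g f)) (@pull_sieve_subproof U V g R).

(* A point v of V over u in U has the same residue field as u iff the point
   Spec k(u) -> U lifts to V; hence a family is completely decomposed iff it is
   surjective on points over fields. *)
Definition nisnevich_cover U (I : Type) (V : I -> Sm k)
    (f : forall i, knat (V i) U) :=
  (forall i, formally_etale (f i)) /\
  (forall (K : fieldType) (iota : {rmorphism k -> K}) (x : U (Alg iota)),
     exists i (y : V i (Alg iota)), f i _ y = x).

(* The Grothendieck topology generated by the Nisnevich covers. *)
Inductive covering : forall U, sieve U -> Prop :=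
| covering_nis U (R : sieve U) (I : Type) (V : I -> Sm k)
    (f : forall i, knat (V i) U) :
    nisnevich_cover f -> (forall i, R (V i) (f i)) -> covering R
| covering_max U (R : sieve U) : (forall V (f : knat V U), R V f) -> covering R
| covering_pull U V (g : knat V U) (R : sieve U) :
    covering R -> covering (pull_sieve g R)
| covering_trans U (R R' : sieve U) :
    covering R -> (forall V (f : knat V U), R V f -> covering (pull_sieve f R')) ->
    covering R'.

Lemma covering_sub U (R R' : sieve U) :
  covering R -> (forall V (f : knat V U), R V f -> R' V f) -> covering R'.
Proof.
move=> cR RR'; apply: (covering_trans cR) => V f Rf.
by apply: covering_max => W g /=; apply: RR'; apply: sieveP.
Qed.

Definition meet_sieve U (R R' : sieve U) : sieve U :=
  @Sieve U (fun V f => R V f /\ R' V f)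
    (fun V W f g Rf => conj (sieveP g Rf.1) (sieveP g Rf.2)).

Lemma covering_meet U (R R' : sieve U) :
  covering R -> covering R' -> covering (meet_sieve R R').
Proof.
move=> cR cR'; apply: (covering_trans cR) => V f Rf.
apply: (covering_sub (covering_pull f cR')) => W g R'g.
by split=> //; apply: sieveP.
Qed.

End NisnevichTopology.

(* The quotient of T by an equivalence relation E, as a set of classes; the
   quotient types of the library need a choiceType, whose universe is too small
   for sections of presheaves on Sm. *)
Section Quotient.
Variables (T : Type) (E : T -> T -> Prop).

Definition quotient := {P : T -> Prop | exists x, P = E x}.

Definition class_of (x : T) : quotient := exist _ (E x) (ex_intro _ x erefl).

Hypotheses (Erefl : forall x, E x x) (Esym : forall x y, E x y -> E y x)
  (Etrans : forall x y z, E x y -> E y z -> E x z).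

Lemma class_of_eq x y : class_of x = class_of y <-> E x y.
Proof.
split=> [[/(congr1 (fun P => P y)) ->] //|xy].
suff e : E x = E y.
  by apply: eq_exist.
apply: funext => z; apply: propext; split=> [|yz]; last exact: Etrans xy yz.
by apply: Etrans; apply: Esym.
Qed.

Definition repr (c : quotient) : T := sval (cid (svalP c)).

Lemma reprK c : class_of (repr c) = c.
Proof.
case: c => P p; rewrite /repr; case: cid => x /= e.
by apply: eq_exist; rewrite e.
Qed.

Lemma repr_class x : E (repr (class_of x)) x.
Proof. by apply/class_of_eq; rewrite reprK. Qed.

End Quotient.

Record presheaf (k : fieldType) := Presheaf {
  sec :> Sm k -> Type;
  res : forall U V : Sm k, knat V U -> sec U -> sec V;
  res_id : forall (U : Sm k) (x : sec U), res (@idNat k U) x = x;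
  res_comp : forall (U V W : Sm k) (f : knat V U) (g : knat W V) x,
    res (compNat f g) x = res g (res f x) }.

Definition points_sheaf (k : fieldType) (X : kfun k) : presheaf k :=
  @Presheaf k (fun U => knat U X) (fun U V g f => compNat f g)
    (fun U f => compNatI f) (fun U V W f g x => compNatA x f g).

Section Sheafification.
Variable k : fieldType.
Implicit Types (F G : presheaf k) (U V W : Sm k).

Section QuotientPresheaf.
Variables (T : Sm k -> Type) (r : forall U V, knat V U -> T U -> T V)
  (E : forall U, T U -> T U -> Prop).
Hypotheses (Erefl : forall U (x : T U), E x x)
  (Esym : forall U (x y : T U), E x y -> E y x)
  (Etrans : forall U (x y z : T U), E x y -> E y z -> E x z)
  (Eres : forall U V (g : knat V U) (x y : T U), E x y -> E (r g x) (r g y))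
  (Eid : forall U (x : T U), E (r (@idNat k U) x) x)
  (Ecomp : forall U V W (f : knat V U) (g : knat W V) (x : T U),
     E (r (compNat f g) x) (r g (r f x))).

Definition quot_res U V (g : knat V U) (c : quotient (@E U)) : quotient (@E V) :=
  class_of (@E V) (r g (repr c)).

Lemma quot_resE U V (g : knat V U) x :
  quot_res g (class_of (@E U) x) = class_of (@E V) (r g x).
Proof.
by apply/class_of_eq => //; [exact: Esym | exact: Etrans |];
   apply: Eres; apply: repr_class; [exact: Erefl|exact: Esym|exact: Etrans].
Qed.

Lemma quot_res_id U c : quot_res (@idNat k U) c = c.
Proof.
rewrite -(reprK c) quot_resE; apply/class_of_eq => //; [exact: Esym | exact: Etrans].
Qed.

Lemma quot_res_comp U V W (f : knat V U) (g : knat W V) c :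
  quot_res (compNat f g) c = quot_res g (quot_res f c).
Proof.
rewrite -(reprK c) !quot_resE; apply/class_of_eq => //; [exact: Esym | exact: Etrans].
Qed.

Definition quot_presheaf : presheaf k := Presheaf quot_res_id quot_res_comp.

End QuotientPresheaf.

(* A^1-homotopy *)
Definition A1_homotopic F U (x0 x1 : F U) :=
  exists h : F (A1x U), res (at_pt 0 U) h = x0 /\ res (at_pt 1 U) h = x1.

Definition A1_equiv F U : F U -> F U -> Prop :=
  clos_refl_sym_trans (F U) (@A1_homotopic F U).

Lemma A1_equiv_res F U V (g : knat V U) x y :
  @A1_equiv F U x y -> @A1_equiv F V (res g x) (res g y).
Proof.
elim=> [{}x {}y [h [<- <-]]|{}x|{}x {}y _|{}x {}y z _ xy _ yz].
- apply: rst_step; exists (res (A1x_map g) h).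
  by rewrite -!res_comp !at_pt_nat.
- exact: rst_refl.
- exact: rst_sym.
- exact: rst_trans xy yz.
Qed.

Lemma A1_equiv_eq F U (x y : F U) : x = y -> A1_equiv x y.
Proof. by move->; apply: rst_refl. Qed.

(* U |-> F(U) / ~ *)
Definition naive_pi0 F : presheaf k :=
  @quot_presheaf (sec F) (@res k F) (@A1_equiv F)
    (fun U => rst_refl _ _) (fun U => rst_sym _ _) (fun U => rst_trans _ _)
    (@A1_equiv_res F)
    (fun U x => A1_equiv_eq (res_id x))
    (fun U V W f g x => A1_equiv_eq (res_comp f g x)).

(* Sections of F^+ over U are represented by matching families on covering
   sieves, up to equality on a common covering refinement; the sheaf associated
   to F is F^{++} (Mac Lane-Moerdijk, Sheaves in Geometry and Logic, III.5). *)
Record matching F U := Matching {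
  m_sieve : sieve U;
  m_cov : covering m_sieve;
  m_val : forall V (f : knat V U), m_sieve V f -> F V;
  m_res : forall V W (f : knat V U) (g : knat W V)
    (Rf : m_sieve V f) (Rfg : m_sieve W (compNat f g)),
    res g (m_val Rf) = m_val Rfg }.

Definition matching_equiv F U (x y : matching F U) :=
  exists R : sieve U, [/\ covering R,
    forall V (f : knat V U), R V f -> m_sieve x V f /\ m_sieve y V f
  & forall V (f : knat V U) (xf : m_sieve x V f) (yf : m_sieve y V f),
      R V f -> m_val xf = m_val yf].

Lemma matching_pull_subproof F U V (g : knat V U) (x : matching F U)
    W W' (f : knat W V) (h : knat W' W)
    (Rf : pull_sieve g (m_sieve x) W f)
    (Rfh : pull_sieve g (m_sieve x) W' (compNat f h)) :
  res h (m_val Rf) = m_val Rfh.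
Proof. by move: Rfh; rewrite /= compNatA => Rfh; apply: m_res. Qed.

Definition matching_pull F U V (g : knat V U) (x : matching F U) : matching F V :=
  @Matching F V (pull_sieve g (m_sieve x)) (covering_pull g (m_cov x))
    (fun W f Rf => m_val Rf) (@matching_pull_subproof F U V g x).

Lemma m_valE F U (x : matching F U) V (f g : knat V U)
  (xf : m_sieve x V f) (xg : m_sieve x V g) : f = g -> m_val xf = m_val xg.
Proof. by move=> fg; case: _ / fg in xg *; rewrite (Prop_irrelevance xf xg). Qed.

Lemma matching_refl F U (x : matching F U) : matching_equiv x x.
Proof.
by exists (m_sieve x); split=> [||*]; [exact: m_cov| |exact: m_valE].
Qed.

Lemma matching_sym F U (x y : matching F U) :
  matching_equiv x y -> matching_equiv y x.
Proof.
by move=> [R [cR RR Rv]]; exists R; split=> // [V f /RR[]//|V f yf xf /Rv ->].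
Qed.

Lemma matching_trans F U (x y z : matching F U) :
  matching_equiv x y -> matching_equiv y z -> matching_equiv x z.
Proof.
move=> [R [cR RR Rv]] [Q [cQ QQ Qv]]; exists (meet_sieve R Q).
split=> [|V f [/RR[? _] /QQ[_ ?]]//|V f xf zf [Rf Qf]].
  exact: covering_meet.
by have [_ yf] := RR _ _ Rf; rewrite (Rv _ _ xf yf) // (Qv _ _ yf zf).
Qed.

Lemma matching_equiv_pull F U V (g : knat V U) (x y : matching F U) :
  matching_equiv x y -> matching_equiv (matching_pull g x) (matching_pull g y).
Proof.
move=> [R [cR RR Rv]]; exists (pull_sieve g R); split.
- exact: covering_pull.
- by move=> W f /RR.
- by move=> W f xf yf; apply: Rv.
Qed.

Lemma matching_pull_id F U (x : matching F U) :
  matching_equiv (matching_pull idNat x) x.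
Proof.
exists (m_sieve x); split=> [|V f xf|V f xf yf _]; first exact: m_cov.
  by rewrite /= compINat.
exact: (@m_valE F U x V (compNat idNat f) f xf yf (compINat f)).
Qed.

Lemma matching_pull_comp F U V W (f : knat V U) (g : knat W V) (x : matching F U) :
  matching_equiv (matching_pull (compNat f g) x) (matching_pull g (matching_pull f x)).
Proof.
exists (pull_sieve (compNat f g) (m_sieve x)).
split=> [|W' h xh|W' h xh yh _]; first exact: covering_pull (m_cov x).
  by split=> //=; rewrite compNatA.
exact: (@m_valE F U x W' (compNat (compNat f g) h) (compNat f (compNat g h))
          xh yh (esym (compNatA f g h))).
Qed.

Definition plus F : presheaf k :=
  @quot_presheaf (matching F) (@matching_pull F) (@matching_equiv F)
    (@matching_refl F) (@matching_sym F) (@matching_trans F)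
    (@matching_equiv_pull F) (@matching_pull_id F) (@matching_pull_comp F).

Definition max_sieve U : sieve U :=
  @Sieve k U (fun _ _ => True) (fun _ _ _ _ => id).

Definition to_matching F U (x : F U) : matching F U :=
  @Matching F U (max_sieve U) (@covering_max k U (max_sieve U) (fun _ _ => I))
    (fun V f _ => res f x) (fun V W f g _ _ => esym (res_comp f g x)).

Definition to_plus F U (x : F U) : plus F U := class_of _ (to_matching x).

Definition sheafify F : presheaf k := plus (plus F).

Definition S_ F : presheaf k := sheafify (naive_pi0 F).

Definition to_S F U (x : F U) : S_ F U :=
  to_plus (to_plus (class_of (@A1_equiv F U) x : naive_pi0 F U)).

(* iter lives in too small a universe for this *)
Fixpoint S_iter (m : nat) F : presheaf k := if m is i.+1 then S_ (S_iter i F) else F.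

(* x |-> [x]_j *)
Fixpoint to_S_iter F U (j : nat) (x : F U) : S_iter j F U :=
  if j is i.+1 then to_S (to_S_iter i x) else x.

End Sheafification.

(* The section over Spec k defined by a k-rational point *)
Section RationalPoints.
Variables (k : fieldType) (X : kfun k) (x : X (baseAlg k)).

Lemma pt_section_subproof A B (f : algHom A B) (s : SpecBase k A) :
  pmap (pmap f s) x = pmap f (pmap s x).
Proof. by rewrite /= pmap_comp. Qed.

Definition pt_section : points_sheaf X (SpecBase k) :=
  @KNat k (SpecBase k) X (fun A s => pmap s x) pt_section_subproof.

End RationalPoints.

Section Varieties.
Variables (k : fieldType) (lam1 lam2 lam3 : k).
Implicit Types A B C : alg k.

Definition cubic A (x : A) : A :=
  (x - alg_in A lam1) * (x - alg_in A lam2) * (x - alg_in A lam3).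

(* An A-point of the hypersurface avoids the origin when its coordinates
   generate the unit ideal of A. *)
Record X1_pt A := X1Pt {
  px0 : A; px1 : A; py1 : A;
  X1_eq : py1 ^+ 2 = px0 ^+ 2 * cubic px1;
  X1_ne0 : exists a b c, a * px0 + b * px1 + c * py1 = 1 }.

Lemma X1_pt_eq A (p q : X1_pt A) :
  px0 p = px0 q -> px1 p = px1 q -> py1 p = py1 q -> p = q.
Proof.
case: p q => [a b c e n] [a' b' c' e' n'] /= aa bb cc.
case: _ / aa in e' n' *; case: _ / bb in e' n' *; case: _ / cc in e' n' *.
by rewrite (Prop_irrelevance e' e) (Prop_irrelevance n' n).
Qed.

Lemma X1_map_eq A B (f : algHom A B) (p : X1_pt A) :
  f (py1 p) ^+ 2 = f (px0 p) ^+ 2 * cubic (f (px1 p)).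
Proof.
by rewrite -!rmorphXn X1_eq rmorphM /cubic !rmorphM !rmorphB !homP.
Qed.

Lemma X1_map_ne0 A B (f : algHom A B) (p : X1_pt A) :
  exists a b c, a * f (px0 p) + b * f (px1 p) + c * f (py1 p) = 1.
Proof.
have [a [b [c e]]] := X1_ne0 p; exists (f a), (f b), (f c).
by rewrite -!rmorphM -!rmorphD e rmorph1.
Qed.

Definition X1_map A B (f : algHom A B) (p : X1_pt A) : X1_pt B :=
  X1Pt (X1_map_eq f p) (X1_map_ne0 f p).

Lemma X1_map_id A (p : X1_pt A) : X1_map idHom p = p.
Proof. exact: X1_pt_eq. Qed.

Lemma X1_map_comp A B C (g : algHom B C) (f : algHom A B) (p : X1_pt A) :
  X1_map (compHom g f) p = X1_map g (X1_map f p).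
Proof. exact: X1_pt_eq. Qed.

Definition X1 : kfun k := KFun X1_map_id X1_map_comp.

Definition phi1 : knat X1 (A1 k) :=
  @KNat k X1 (A1 k) (fun A p => px0 p) (fun A B f p => erefl).

Definition psi1 : knat X1 (A1 k) :=
  @KNat k X1 (A1 k) (fun A p => px1 p) (fun A B f p => erefl).

(* The n-fold fiber product X1 x_(psi1, A^1, phi1) ... x_(psi1, A^1, phi1) X1;
   only n >= 1 is relevant. *)
Definition chainable A n (p : 'I_n -> X1 A) : Prop :=
  forall i j : 'I_n, j = i.+1 :> nat -> psi1 A (p i) = phi1 A (p j).

Definition Xn_pt n A := {p : 'I_n -> X1 A | chainable p}.

Lemma Xn_pt_eq n A (p q : Xn_pt n A) : (forall i, sval p i = sval q i) -> p = q.
Proof. by case: p q => [p pP] [q qP] /= /funext pq; apply: eq_exist. Qed.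

Lemma Xn_map_subproof n A B (f : algHom A B) (p : Xn_pt n A) :
  chainable (fun i => pmap f (sval p i)).
Proof. by move=> i j ij; rewrite !natP (svalP p i j ij). Qed.

Definition Xn_map n A B (f : algHom A B) (p : Xn_pt n A) : Xn_pt n B :=
  exist _ _ (Xn_map_subproof f p).

Lemma Xn_map_id n A (p : Xn_pt n A) : Xn_map idHom p = p.
Proof. by apply: Xn_pt_eq => i; exact: pmap_id. Qed.

Lemma Xn_map_comp n A B C (g : algHom B C) (f : algHom A B) (p : Xn_pt n A) :
  Xn_map (compHom g f) p = Xn_map g (Xn_map f p).
Proof. by apply: Xn_pt_eq => i; exact: pmap_comp. Qed.

Definition Xn n : kfun k := KFun (@Xn_map_id n) (@Xn_map_comp n).

(* phi_n and psi_n, the projections to the first and the last n-1 factors *)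
Lemma phin_subproof n A (p : Xn n.+1 A) :
  chainable (fun i : 'I_n => sval p (widen_ord (leqnSn n) i)).
Proof. by move=> i j ij; apply: (svalP p). Qed.

Lemma phin_nat n A B (f : algHom A B) (p : Xn n.+1 A) :
  exist _ _ (phin_subproof (pmap f p))
    = pmap f (exist _ _ (phin_subproof p) : Xn n A).
Proof. exact: Xn_pt_eq. Qed.

Definition phin n : knat (Xn n.+1) (Xn n) :=
  @KNat k (Xn n.+1) (Xn n) (fun A p => exist _ _ (phin_subproof p)) (@phin_nat n).

Lemma psin_subproof n A (p : Xn n.+1 A) :
  chainable (fun i : 'I_n => sval p (lift ord0 i)).
Proof. by move=> i j ij; apply: (svalP p); rewrite !lift0 ij. Qed.

Lemma psin_nat n A B (f : algHom A B) (p : Xn n.+1 A) :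
  exist _ _ (psin_subproof (pmap f p))
    = pmap f (exist _ _ (psin_subproof p) : Xn n A).
Proof. exact: Xn_pt_eq. Qed.

Definition psin n : knat (Xn n.+1) (Xn n) :=
  @KNat k (Xn n.+1) (Xn n) (fun A p => exist _ _ (psin_subproof p)) (@psin_nat n).

(* The inductive description X_n = X_{n-1} x_(psi, X_{n-2}, phi) X_{n-1}:
   n = 1, n = 2, and n >= 3. *)
Lemma X1_chain A (x : X1 A) : exists! z : Xn 1 A, sval z ord0 = x.
Proof.
have c : chainable (fun _ : 'I_1 => x) by move=> i j; rewrite !ord1.
exists (exist _ _ c); split=> // z zx.
by apply: Xn_pt_eq => i; rewrite ord1 zx.
Qed.

Lemma X2_pullback A (x y : Xn 1 A) :
  psi1 A (sval x ord0) = phi1 A (sval y ord0) ->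
  exists! z : Xn 2 A, phin 1 A z = x /\ psin 1 A z = y.
Proof.
move=> xy; pose p (i : 'I_2) := if i == ord0 then sval x ord0 else sval y ord0.
have c : chainable p.
  by case=> [[|[|i]] //= ?] [[|[|j]] //= ?].
exists (exist _ p c); split=> [|z [zx zy]].
  by split; apply: Xn_pt_eq => i; rewrite ord1.
apply: Xn_pt_eq => i /=; rewrite /p -zx -zy; case: eqP => [->|] /=.
  by congr (sval z _); apply: val_inj.
case: i => [[|[|i]] //= ?]; first by case; apply: val_inj.
by move=> _; congr (sval z _); apply: val_inj.
Qed.

Lemma Xn_square n A (z : Xn n.+2 A) :
  psin n A (phin n.+1 A z) = phin n A (psin n.+1 A z).
Proof. by apply: Xn_pt_eq => i /=; congr (sval z _); apply: val_inj. Qed.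

Lemma Xn_pullback n A (x y : Xn n.+2 A) : psin n.+1 A x = phin n.+1 A y ->
  exists! z : Xn n.+3 A, phin n.+2 A z = x /\ psin n.+2 A z = y.
Proof.
move=> xy.
have xyE (i : 'I_n.+1) : sval x (lift ord0 i) = sval y (widen_ord (leqnSn _) i).
  by have /(congr1 (fun p : Xn _ A => sval p i)) := xy.
pose p (i : 'I_n.+3) := if unlift ord0 i is Some j then sval y j else sval x ord0.
have pS (j : 'I_n.+2) : p (lift ord0 j) = sval y j by rewrite /p liftK.
have p0 : p ord0 = sval x ord0 by rewrite /p unlift_none.
have c : chainable p.
  move=> i; case: (unliftP ord0 i) => [i'|] -> j;
    case: (unliftP ord0 j) => [j'|] -> //; rewrite ?p0 ?pS ?lift0.
    by move=> [ij]; apply: (svalP y).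
  move=> [j0]; have -> : j' = widen_ord (leqnSn _) (ord0 : 'I_n.+1) by apply: val_inj.
  by rewrite -xyE; apply: (svalP x); rewrite lift0.
exists (exist _ p c); split=> [|z [zx zy]].
  split; apply: Xn_pt_eq => i /=; last by rewrite pS.
  case: (unliftP ord0 i) => [j|] ->.
    have -> : widen_ord (leqnSn _) (lift ord0 j)
            = lift ord0 (widen_ord (leqnSn n.+1) j) by apply: val_inj.
    by rewrite pS -xyE.
  have -> : widen_ord (leqnSn _) ord0 = ord0 :> 'I_n.+3 by apply: val_inj.
  by rewrite p0.
apply: Xn_pt_eq => i /=; rewrite /p -zx -zy.
case: (unliftP ord0 i) => [j|] -> //=.
by congr (sval z _); apply: val_inj.
Qed.

Variables (lam : k) (lamP : lam ^+ 2 = - (lam1 * lam2 * lam3)).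

Lemma alpha1_eq : lam ^+ 2 = 1 ^+ 2 * cubic (0 : baseAlg k).
Proof. by rewrite lamP /cubic /=; ring. Qed.

Lemma alpha1_ne0 : exists a b c : k, a * 1 + b * 0 + c * lam = 1.
Proof. by exists 1, 0, 0; ring. Qed.

Definition alpha1 : X1 (baseAlg k) :=
  @X1Pt (baseAlg k) 1 0 lam alpha1_eq alpha1_ne0.

Lemma beta1_eq : 0 ^+ 2 = 0 ^+ 2 * cubic (1 : baseAlg k).
Proof. by rewrite !expr0n mul0r. Qed.

Lemma beta1_ne0 : exists a b c : k, a * 0 + b * 1 + c * 0 = 1.
Proof. by exists 0, 1, 0; ring. Qed.

Definition beta1 : X1 (baseAlg k) :=
  @X1Pt (baseAlg k) 0 1 0 beta1_eq beta1_ne0.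

Lemma alpha_chain n : chainable (fun i : 'I_n => if odd i then beta1 else alpha1).
Proof. by move=> i j -> /=; case: (odd i). Qed.

Definition alpha n : Xn n (baseAlg k) := exist _ _ (@alpha_chain n).

Lemma beta_chain n : chainable (fun i : 'I_n => if odd i then alpha1 else beta1).
Proof. by move=> i j -> /=; case: (odd i). Qed.

Definition beta n : Xn n (baseAlg k) := exist _ _ (@beta_chain n).

End Varieties.

(* Main.v *)
Require Import Defs.
From Stdlib Require Import Relation_Operators.
From HB Require Import structures.
From mathcomp Require Import all_boot all_order all_algebra.
From mathcomp Require Import ring.
From mathcomp Require Import boolp.
From mathcomp Require Import reals complex.

(* For [n >= 1], [X_n] is the pullback of [psi_1 : X_1 -> A^1] along the map
   [x : X_(n-1) -> A^1] given by the first coordinate, with [X_0 = A^1].  This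
   yields a natural map [sigma : X_(n-1) -> S(X_n)]: where [x] is invertible,
   lift a point by [(0, x, 0)] in [X_1]; on the part of the etale double cover
   [s^2 = f(x)] on which [s = lambda] along [x = 0], lift it by [(1, x, s)].
   The two loci form a Nisnevich cover, and two such lifts are naively
   A^1-homotopic, as [(u, x, s u)] lies in [X_1] as soon as [u] and [x] generate
   the unit ideal.  Since [sigma] maps [alpha_(n-1)] to [[beta_n]_1] and
   [beta_(n-1)] to [[alpha_n]_1], the functor [S^(n-1)] carries a homotopy in
   [S^(n-1)(X_(n-1))] to one in [S^n(X_n)]; the induction starts with the points
   0 and 1 of [A^1]. *)

Set Implicit Arguments.
Unset Strict Implicit.
Unset Printing Implicit Defensive.

Import Defs GRing.Theory.
Local Open Scope ring_scope.

(** * Zero loci and formally etale maps *)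

Section ClosedSubschemes.
Variable k : fieldType.
Implicit Types (A B C : alg k) (X Y Z : kfun k).

(** The algebra [B/(b)]. The product is transported along a chosen section [r] of the projection;
    the quotient may be the zero ring, namely when [b] is a unit. *)
Lemma quotient_alg B (b : B) : exists (Q : alg k) (p : algHom B Q),
  [/\ forall y, exists x, p x = y, p b = 0
    & forall A (g : algHom B A), g b = 0 -> exists h : algHom Q A, compHom h p = g].
Proof.
pose I0 : pred B := fun x => `[< exists y, x = y * b >].
have I0P : zmod_closed I0.
  split; first by apply/asboolP; exists 0; rewrite mul0r.
  move=> x y /asboolP[u ->] /asboolP[v ->]; apply/asboolP.
  by exists (u - v); rewrite mulrBl.
pose I : zmodClosed B := HB.pack I0 (GRing.isZmodClosed.Build B I0 I0P).
pose Q0 : zmodType := Quotient.quot I.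
pose pi : B -> Q0 := \pi_(Quotient.quot I)%qT.
have piE x y : pi x = pi y <-> exists z, x = y + z * b.
  split=> [/eqP|[z ->]].
    rewrite /pi -Quotient.idealrBE => /asboolP[z xyz]; exists z.
    by rewrite -xyz addrC subrK.
  by apply/eqP; rewrite /pi -Quotient.idealrBE; apply/asboolP; exists z; ring.
have piB : {morph pi : x y / x - y} by move=> x y; rewrite /pi raddfB.
have piD : {morph pi : x y / x + y} by move=> x y; rewrite /pi raddfD.
have piK (c : Q0) : exists x, pi x = c.
  by exists (generic_quotient.repr c); rewrite /pi generic_quotient.reprK.
have /choice[r rK] := piK.
pose mul (x y : Q0) := pi (r x * r y).
have mulE x y : mul (pi x) (pi y) = pi (x * y).
  have /piE[u eu] := rK (pi x); have /piE[v ev] := rK (pi y).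
  by apply/piE; exists (u * y + x * v + u * v * b); rewrite eu ev; ring.
have mulA : associative mul.
  move=> x y z; have [[[{}x <-] [{}y <-]] [{}z <-]] := (piK x, piK y, piK z).
  by rewrite !mulE mulrA.
have mulC : commutative mul by move=> x y; rewrite /mul mulrC.
have mul1 : left_id (pi 1) mul.
  by move=> x; have [{}x <-] := piK x; rewrite mulE mul1r.
have mulD : left_distributive mul +%R.
  move=> x y z; have [[[{}x <-] [{}y <-]] [{}z <-]] := (piK x, piK y, piK z).
  by rewrite -piD !mulE -piD mulrDl.
pose Q : comPzRingType := HB.pack Q0
  (GRing.Zmodule_isComPzRing.Build Q0 mulA mulC mul1 mulD).
have [p pE] : exists p : {rmorphism B -> Q}, p =1 pi.
  by apply: mk_rmorphism => // x y; rewrite -mulE.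
pose p' : algHom B (Alg (p \o alg_in B)) :=
  @AlgHom k B (@Alg k Q (p \o alg_in B)) p (fun=> erefl).
exists _, p'; split=> [y||A g gb].
- by have [x <-] := piK y; exists x; rewrite /= pE.
- by rewrite /= pE -[RHS](raddf0 (\pi_(Quotient.quot I)%qT)); apply/piE; exists 1; ring.
have gr x : g (r (pi x)) = g x.
  have /piE[z ->] := rK (pi x).
  by rewrite rmorphD rmorphM gb mulr0 addr0.
have [h hE] : exists h : {rmorphism Q -> A}, h =1 g \o r.
  apply: mk_rmorphism => [x y||x y] /=; last 2 first.
  - by rewrite gr rmorph1.
  - have [[{}x <-] [{}y <-]] := (piK x, piK y).
    by rewrite [_ * _]mulE !gr rmorphM.
  have [[{}x <-] [{}y <-]] := (piK x, piK y).
  by rewrite -piB !gr rmorphB.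
have hP c : h (alg_in (Alg (p \o alg_in B)) c) = alg_in A c.
  by rewrite hE /= pE gr homP.
by exists (AlgHom hP); apply: algHom_eq => x; rewrite /= hE /= pE gr.
Qed.

(** * Closed subschemes cut out by one function *)

Section ZeroLocus.
Variables (X : kfun k) (F : knat X (A1 k)).

Definition zero_locus_pt A := {x : X A | F A x = 0}.

Lemma zero_locus_pt_eq A (x y : zero_locus_pt A) : sval x = sval y -> x = y.
Proof. by case: x y => [x xP] [y yP] /= xy; apply: eq_exist. Qed.

Lemma zero_locus_map_subproof A B (f : algHom A B) (x : zero_locus_pt A) :
  F B (pmap f (sval x)) = 0.
Proof. by rewrite natP (svalP x) /= rmorph0. Qed.

Definition zero_locus_map A B (f : algHom A B) (x : zero_locus_pt A) : zero_locus_pt B :=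
  exist _ _ (zero_locus_map_subproof f x).

Lemma zero_locus_map_id A (x : zero_locus_pt A) : zero_locus_map idHom x = x.
Proof. by apply: zero_locus_pt_eq; apply: pmap_id. Qed.

Lemma zero_locus_map_comp A B C (g : algHom B C) (f : algHom A B) (x : zero_locus_pt A) :
  zero_locus_map (compHom g f) x = zero_locus_map g (zero_locus_map f x).
Proof. by apply: zero_locus_pt_eq; apply: pmap_comp. Qed.

Definition zero_locus : kfun k := KFun zero_locus_map_id zero_locus_map_comp.

Definition zero_locus_point A (x : X A) (Fx : F A x = 0) : zero_locus A :=
  exist _ x Fx.

Lemma zero_locus_sheaf : zariski_sheaf X -> zariski_sheaf zero_locus.
Proof.
move=> HX A n a a1 A_ l A__ r1 r2 Ll Lr r12 s s12.
have [|x [xP xU]] := HX _ _ _ a1 _ _ _ _ _ Ll Lr r12 (fun i => sval (s i)).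
  by move=> i j; have /(congr1 sval) := s12 i j.
have Fx0 : F A x = 0.
  have [|z [_ zU]] := A1_sheaf a1 Ll Lr r12 (s := fun=> 0).
    by move=> i j; rewrite /= !rmorph0.
  rewrite -(zU (F A x)) => [|i]; last by rewrite -natP xP (svalP (s i)).
  by apply: zU => i; rewrite /= rmorph0.
exists (exist _ x Fx0); split=> [i|[y Fy] yP]; apply: zero_locus_pt_eq => /=.
  exact: xP.
by apply: xU => i; rewrite -yP.
Qed.

(** By Yoneda [F] restricts on the chart [Spec B] to an element of [B], its value at the universal
    point; the chart of the zero locus is [Spec] of the quotient by that element. *)
Lemma zero_locus_affine B (j : knat (Spec B) X) : fg_alg B -> open_immersion j ->
  exists QJ : {Q : alg k & knat (Spec Q) zero_locus},
    [/\ fg_alg (projT1 QJ), open_immersion (projT2 QJ)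
      & forall A (x : zero_locus A) (y : Spec B A), j A y = sval x ->
          exists z, projT2 QJ A z = x].
Proof.
move=> [s sB] [jinj jop].
have jE A (y : Spec B A) : F A (j A y) = y (F B (j B (@idHom k B))).
  by rewrite -[y in LHS]compHomI -[compHom _ _]/(@pmap _ (Spec B) _ _ y idHom) !natP.
have [Q [p [psurj pF pU]]] := quotient_alg (F B (j B (@idHom k B))).
have F0 A (h : Spec Q A) : F A (j A (compHom h p)) = 0.
  by rewrite jE /= pF rmorph0.
have nt A C (f : algHom A C) (h : Spec Q A) :
    exist _ _ (F0 C (pmap f h)) = pmap f (exist _ _ (F0 A h) : zero_locus A).
  by apply: zero_locus_pt_eq; rewrite /= -natP /= compHomA.
pose J := @KNat k (Spec Q) zero_locus _ nt.
have Jlift A (x : zero_locus A) (y : Spec B A) : j A y = sval x -> exists z, J A z = x.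
  move=> yx; have [|h hp] := pU A y; first by rewrite -jE yx (svalP x).
  by exists h; apply: zero_locus_pt_eq; rewrite /= hp.
exists (existT _ Q J); split=> //=.
- exists (map p s) => P Pc PD PM Ps y; have [x <-] := psurj y.
  apply: (sB (fun x => P (p x))) => [c|u v|u v|u us]; rewrite ?homP ?rmorphD ?rmorphM //.
  + exact: PD.
  + exact: PM.
  + by apply: Ps; apply: map_f.
- split=> [A g h /(congr1 sval) /= /jinj gh|A x].
    apply: algHom_eq => y; have [u <-] := psurj y.
    by have /(congr1 (fun f : algHom _ _ => f u)) := gh.
  have [E EP] := jop A (sval x); exists E => C f; rewrite -EP; split.
    by move=> [h /(congr1 sval) /= hx]; exists (compHom h p).
  by move=> [y yx]; apply: (Jlift _ _ y).
Qed.

Lemma zero_locus_scheme : scheme_of_finite_type X -> scheme_of_finite_type zero_locus.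
Proof.
move=> [shX [n [B [j [Bfg jo jc]]]]]; split; first exact: zero_locus_sheaf.
have /choice[QJ QJP] := fun i => zero_locus_affine (Bfg i) (jo i).
exists n, (fun i => projT1 (QJ i)), (fun i => projT2 (QJ i)); split.
- by move=> i; have [] := QJP i.
- by move=> i; have [] := QJP i.
move=> K iota x; have [i [y yx]] := jc K iota (sval x).
by have [_ _ /(_ _ x y yx) [z zP]] := QJP i; exists i, z.
Qed.

End ZeroLocus.

(** * Formally etale maps and hypersurfaces in [A^1 x X] *)

Lemma formally_etale_smooth X Y (f : knat X Y) :
  formally_etale f -> formally_smooth Y -> formally_smooth X.
Proof.
move=> fe Ys A B p pP x; have [y yx] := Ys A B p pP (f B x).
by have [z [[zx _] _]] := fe A B p pP x y (esym yx); exists z.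
Qed.

(* [g] need not be etale outside the image of [f]: it will be the projection of
   the curve of roots of an equation, and [f] the locus where the roots are
   simple. *)
Lemma formally_etale_comp X Y Z (g : knat Y Z) (f : knat X Y) :
  (forall A B (p : algHom A B), square_zero_ext p ->
     forall (x : X B) (z : Z A), g B (f B x) = pmap p z ->
     exists! y : Y A, pmap p y = f B x /\ g A y = z) ->
  formally_etale f -> formally_etale (compNat g f).
Proof.
move=> ge fe A B p pP x z xz.
have [y [[yx yz] yU]] := ge A B p pP x z xz.
have [w [[wx wy] wU]] := fe A B p pP x y (esym yx).
exists w; split=> [|w' [w'x w'z]]; first by rewrite /= wy.
apply: wU; split=> //; apply/esym/yU; split=> //.
by rewrite -natP w'x.
Qed.

Section Hypersurface.
Variables (X : kfun k) (G : knat (kprod (A1 k) X) (A1 k)).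

Definition hypersurface_proj : knat (zero_locus G) X :=
  @KNat k (zero_locus G) X (fun A x => (sval x).2) (fun A B f x => erefl).

(** The component in [X] of a lift is prescribed, so that only the [A^1]-coordinate remains to be
    lifted. *)
Lemma hypersurface_lift A B (p : algHom A B) (z : zero_locus G B) (x : X A) :
  hypersurface_proj B z = pmap p x ->
  (G B ((sval z).1, pmap p x) = 0 ->
     exists! a, p a = (sval z).1 /\ G A (a, x) = 0) ->
  exists! w : zero_locus G A, pmap p w = z /\ hypersurface_proj A w = x.
Proof.
case: z => [[b y] Gb] /= yx [|a [[ab Ga] aU]]; first by rewrite -yx.
exists (exist _ (a, x) Ga); split=> [|[[a' x'] Ga'] [/(congr1 sval) /= []]].
  by split=> //; apply: zero_locus_pt_eq; rewrite /= ab yx.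
move=> a'b _ x'x; apply: zero_locus_pt_eq => /=.
by move: Ga'; rewrite x'x => Ga'; rewrite (aU a').
Qed.

End Hypersurface.

Section InverseLocus.
Variables (X : kfun k) (F : knat X (A1 k)).

Lemma inverse_eqn_subproof A B (f : algHom A B) (x : kprod (A1 k) X A) :
  f x.1 * F B (pmap f x.2) - 1 = f (x.1 * F A x.2 - 1).
Proof. by rewrite natP rmorphB rmorphM rmorph1. Qed.

(** The equation [t * F = 1]: it presents the open locus where [F] is invertible as a zero locus in
    [A^1 x X]. *)
Definition inverse_eqn : knat (kprod (A1 k) X) (A1 k) :=
  @KNat k (kprod (A1 k) X) (A1 k) (fun A x => x.1 * F A x.2 - 1)
    inverse_eqn_subproof.

(** If [a] lifts an inverse of the image of [c], then [a * c - 1] has square zero, so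
    [a * (2 - a * c)] inverts [c]. Uniqueness is that of inverses. *)
Lemma inverse_etale : formally_etale (hypersurface_proj inverse_eqn).
Proof.
move=> A B p [psurj p0] z x zx; apply: hypersurface_lift zx _.
move: (sval z).1 => {z} b /= /eqP.
rewrite natP subr_eq0 => /eqP /= bF.
have [a ab] := psurj b; set c := F A x in bF *.
have n2 : (a * c - 1) * (a * c - 1) = 0.
  by apply: p0; rewrite rmorphB rmorphM rmorph1 ab bF subrr.
have vc : a * (1 - (a * c - 1)) * c = 1.
  by apply/eqP; rewrite -subr_eq0; apply/eqP; rewrite -[RHS]oppr0 -n2; ring.
set w := a * _ in vc *; exists w; split=> [|a' [_ /eqP]].
  split; last by apply/eqP; rewrite subr_eq0; apply/eqP.
  by rewrite /w !(rmorphM, rmorphB, rmorph1) ab bF subrr subr0 mulr1.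
rewrite subr_eq0 => /eqP a'c.
by rewrite -[LHS]mulr1 -a'c mulrCA [w * _]vc mulr1.
Qed.

End InverseLocus.

End ClosedSubschemes.

(** * Functoriality of [S] *)

Record pmor (k : fieldType) (F G : presheaf k) := PMor {
  pmor_fun :> forall U, F U -> G U;
  pmorP : forall (U V : Sm k) (g : knat V U) x, pmor_fun (res g x) = res g (pmor_fun x) }.

Section PresheafMorphisms.
Variable k : fieldType.
Implicit Types (F G : presheaf k) (U V W : Sm k).

Definition pmor_id F : pmor F F := @PMor k F F (fun U x => x) (fun _ _ _ _ => erefl).

Lemma A1_homotopic_pmor F G (m : pmor F G) U (x y : F U) :
  A1_homotopic x y -> A1_homotopic (m U x) (m U y).
Proof. by move=> [h [<- <-]]; exists (m _ h); rewrite !pmorP. Qed.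

Lemma A1_equiv_pmor F G (m : pmor F G) U (x y : F U) :
  A1_equiv x y -> A1_equiv (m U x) (m U y).
Proof.
elim=> [{}x {}y xy|{}x|{}x {}y _|{}x {}y z _ xy _ yz].
- by apply: rst_step; apply: A1_homotopic_pmor.
- exact: rst_refl.
- exact: rst_sym.
- exact: rst_trans xy yz.
Qed.

Lemma A1_flip_subproof U A B (f : algHom A B) (x : A1x U A) :
  (1 - f x.1, pmap f x.2) = (f (1 - x.1), pmap f x.2).
Proof. by rewrite rmorphB rmorph1. Qed.

Definition A1_flip U : knat (A1x U) (A1x U) :=
  @KNat k (A1x U) (A1x U) (fun A x => (1 - x.1, x.2)) (@A1_flip_subproof U).

(** Reparametrise by [t |-> 1 - t]. The induction exchanges the two points at each stage, so
    symmetry of the homotopy relation itself is needed, not just of the equivalence it generates. *)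
Lemma A1_homotopic_sym F U (x y : F U) : A1_homotopic x y -> A1_homotopic y x.
Proof.
have flip01 (a b : k) : a + b = 1 -> compNat (A1_flip U) (at_pt a U) = at_pt b U.
  move=> ab; apply: knat_eq => A u /=.
  by rewrite -(rmorph1 (alg_in A)) -rmorphB -ab [a + b]addrC addrK.
move=> [h [<- <-]]; exists (res (A1_flip U) h).
by rewrite -!res_comp (flip01 0 1) ?add0r // (flip01 1 0) ?addr0.
Qed.

Lemma naive_resE F U V (g : knat V U) (x : F U) :
  res g (class_of (@A1_equiv k F U) x : naive_pi0 F U)
    = class_of (@A1_equiv k F V) (res g x).
Proof.
exact: (quot_resE (fun U => rst_refl _ _) (fun U => rst_sym _ _)
  (fun U => rst_trans _ _) (@A1_equiv_res k F)).
Qed.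

Lemma naive_eqE F U (x y : F U) :
  class_of (@A1_equiv k F U) x = class_of (@A1_equiv k F U) y <-> A1_equiv x y.
Proof. exact: (class_of_eq (rst_refl _ _) (rst_sym _ _) (rst_trans _ _)). Qed.

Lemma plus_resE F U V (g : knat V U) (x : matching F U) :
  res g (class_of (@matching_equiv k F U) x : plus F U)
    = class_of (@matching_equiv k F V) (matching_pull g x).
Proof.
exact: (quot_resE (@matching_refl k F) (@matching_sym k F) (@matching_trans k F)
  (@matching_equiv_pull k F)).
Qed.

Lemma plus_eqE F U (x y : matching F U) :
  class_of (@matching_equiv k F U) x = class_of (@matching_equiv k F U) y
    <-> matching_equiv x y.
Proof.
exact: (class_of_eq (@matching_refl k F U) (@matching_sym k F U)
  (@matching_trans k F U)).
Qed.

Lemma to_plus_res F U V (g : knat V U) (x : F U) :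
  to_plus (res g x) = res g (to_plus x).
Proof.
rewrite plus_resE; apply/plus_eqE; exists (max_sieve V); split=> //.
  exact: covering_max.
by move=> W f _ _ _ /=; rewrite res_comp.
Qed.

Section Naive.
Variables (F G : presheaf k) (m : pmor F G).

Definition naive_map U (c : naive_pi0 F U) : naive_pi0 G U :=
  class_of (@A1_equiv k G U) (m U (repr c)).

Lemma naive_mapE U (x : F U) :
  naive_map (class_of (@A1_equiv k F U) x) = class_of (@A1_equiv k G U) (m U x).
Proof.
apply/naive_eqE; apply: A1_equiv_pmor; apply/naive_eqE; exact: reprK.
Qed.

Lemma naive_map_res U V (g : knat V U) (c : naive_pi0 F U) :
  naive_map (res g c) = res g (naive_map c).
Proof. by rewrite -(reprK c) naive_resE !naive_mapE naive_resE pmorP. Qed.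

Definition naive_pmor : pmor (naive_pi0 F) (naive_pi0 G) := PMor naive_map_res.

End Naive.

Section Plus.
Variables (F G : presheaf k) (m : pmor F G).

Lemma matching_map_subproof U (x : matching F U) V W (f : knat V U) (g : knat W V)
    (Rf : m_sieve x V f) (Rfg : m_sieve x W (compNat f g)) :
  res g (m V (m_val Rf)) = m W (m_val Rfg).
Proof. by rewrite -pmorP (m_res Rf Rfg). Qed.

Definition matching_map U (x : matching F U) : matching G U :=
  @Matching k G U (m_sieve x) (m_cov x) (fun V f Rf => m V (m_val Rf))
    (@matching_map_subproof U x).

Lemma matching_map_equiv U (x y : matching F U) :
  matching_equiv x y -> matching_equiv (matching_map x) (matching_map y).
Proof.
move=> [R [cR RR Rv]]; exists R; split=> // V f xf yf Rf /=.
by rewrite (Rv _ _ xf yf).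
Qed.

Definition plus_map U (c : plus F U) : plus G U :=
  class_of (@matching_equiv k G U) (matching_map (repr c)).

Lemma plus_mapE U (x : matching F U) :
  plus_map (class_of (@matching_equiv k F U) x)
    = class_of (@matching_equiv k G U) (matching_map x).
Proof.
apply/plus_eqE; apply: matching_map_equiv; apply/plus_eqE; exact: reprK.
Qed.

Lemma plus_map_res U V (g : knat V U) (c : plus F U) :
  plus_map (res g c) = res g (plus_map c).
Proof.
rewrite -(reprK c) plus_resE !plus_mapE plus_resE.
by apply/plus_eqE; apply: matching_refl.
Qed.

Definition plus_pmor : pmor (plus F) (plus G) := PMor plus_map_res.

Lemma plus_map_to_plus U (x : F U) : plus_map (to_plus x) = to_plus (m U x).
Proof.
rewrite plus_mapE; apply/plus_eqE; exists (max_sieve U); split=> //.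
  exact: covering_max.
by move=> V f _ _ _ /=; rewrite pmorP.
Qed.

End Plus.

Definition S_pmor F G (m : pmor F G) : pmor (S_ F) (S_ G) :=
  plus_pmor (plus_pmor (naive_pmor m)).

Lemma S_pmorE F G (m : pmor F G) U (x : F U) : S_pmor m U (to_S x) = to_S (m U x).
Proof. by rewrite /= plus_map_to_plus /= plus_map_to_plus /= naive_mapE. Qed.

Lemma S_iter_pmor j F G (m : pmor F G) : exists m' : pmor (S_iter j F) (S_iter j G),
  forall U x, m' U (to_S_iter j x) = to_S_iter j (m U x).
Proof.
elim: j => [|j [m' m'E]]; first by exists m.
by exists (S_pmor m') => U x /=; rewrite -m'E; exact: (S_pmorE m').
Qed.

(** [S_iter] puts the new [S_] outermost, whereas the glued map lands in [S_ F] before [S^j] is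
    applied; this comparison map reconciles the two orders. *)
Lemma S_iter_S j F : exists m : pmor (S_iter j (S_ F)) (S_iter j.+1 F),
  forall U (x : F U), m U (to_S_iter j (to_S x)) = to_S_iter j.+1 x.
Proof.
elim: j => [|j [m mE]]; first by exists (pmor_id _).
by exists (S_pmor m) => U x /=; rewrite -[to_S (to_S_iter j x)]mE; exact: (S_pmorE m).
Qed.

End PresheafMorphisms.

(** * Glueing local lifts into a map to [S(G)] *)

Section Glueing.
Variables (k : fieldType) (F G : presheaf k).
Implicit Types U V W : Sm k.
(** [L y z] says that [z] is an admissible lift of [y]. Admissible lifts exist locally and are
    unique only up to naive homotopy. *)
Variable L : forall U, F U -> G U -> Prop.
Hypotheses
  (L_res : forall (U V : Sm k) (g : knat V U) (y : F U) (z : G U),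
     L y z -> L (res g y) (res g z))
  (L_uniq : forall U (y : F U) (z z' : G U), L y z -> L y z' -> A1_equiv z z')
  (L_local : forall U (y : F U), exists R : sieve U, covering R /\
     forall (V : Sm k) (f : knat V U), R V f -> exists z, L (res f y) z).

Lemma lift_sieve_subproof U (y : F U) (V W : Sm k) (f : knat V U) (g : knat W V) :
  (exists z, L (res f y) z) -> exists z, L (res (compNat f g) y) z.
Proof. by move=> [z Lz]; exists (res g z); rewrite res_comp; apply: L_res. Qed.

Definition lift_sieve U (y : F U) : sieve U :=
  @Sieve k U (fun V f => exists z, L (res f y) z) (@lift_sieve_subproof U y).

Lemma lift_sieve_covering U (y : F U) : covering (lift_sieve y).
Proof. by have [R [cR RL]] := L_local y; apply: (covering_sub cR) => V f /RL. Qed.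

Definition lift_val U (y : F U) V (f : knat V U) (Rf : lift_sieve y V f) :
    naive_pi0 G V :=
  class_of (@A1_equiv k G V) (sval (cid Rf)).

Lemma lift_valE U (y : F U) V (f : knat V U) (Rf : lift_sieve y V f) z :
  L (res f y) z -> lift_val Rf = class_of (@A1_equiv k G V) z.
Proof.
by move=> Lz; apply/naive_eqE; apply: L_uniq Lz; exact: (svalP (cid Rf)).
Qed.

Lemma lift_val_res U (y : F U) V W (f : knat V U) (g : knat W V)
    (Rf : lift_sieve y V f) (Rfg : lift_sieve y W (compNat f g)) :
  res g (lift_val Rf) = lift_val Rfg.
Proof.
have [z Lz] := Rf; rewrite (lift_valE Rf Lz) naive_resE; apply/esym/lift_valE.
by rewrite res_comp; apply: L_res.
Qed.

(** By [L_uniq] the class of a lift in [naive_pi0 G] does not depend on the lift, so the classes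
    match although the chosen lifts need not. *)
Definition lift_matching U (y : F U) : matching (naive_pi0 G) U :=
  Matching (lift_sieve_covering y) (@lift_val_res U y).

(** The matching family is already a section of the first [plus]; [to_plus] carries it to the
    second. *)
Definition glue U (y : F U) : S_ G U :=
  @to_plus k (plus (naive_pi0 G)) U
    (class_of (@matching_equiv k (naive_pi0 G) U) (lift_matching y)).

Lemma glue_res U V (g : knat V U) (y : F U) : glue (res g y) = res g (glue y).
Proof.
rewrite /glue -to_plus_res plus_resE; congr to_plus; apply/plus_eqE.
exists (lift_sieve (res g y)); split.
- exact: lift_sieve_covering.
- by move=> W f [z Lz]; split; exists z; rewrite //= res_comp.
move=> W f xf yf [z Lz]; rewrite /= (lift_valE xf Lz).
by apply/esym/lift_valE; rewrite res_comp.
Qed.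

Lemma glueE U (y : F U) z : L y z -> glue y = to_S z.
Proof.
move=> Lz; congr to_plus; apply/plus_eqE.
exists (lift_sieve y); split=> //; first exact: lift_sieve_covering.
move=> V f xf yf _; rewrite [LHS](lift_valE xf (L_res f Lz)).
exact: esym (naive_resE f z).
Qed.

Lemma exists_glue : exists m : pmor F (S_ G), forall U y z, L y z -> m U y = to_S z.
Proof. by exists (PMor glue_res); exact: glueE. Qed.

End Glueing.

(** * The map from [X_(n-1)] to [S(X_n)] *)

Section DoubleCover.
Variables (k : fieldType) (lam1 lam2 lam3 lam : k).
Hypotheses (two_neq0 : (2 : k) != 0) (lam_neq0 : lam != 0)
  (lamP : lam ^+ 2 = - (lam1 * lam2 * lam3)).
Implicit Types (A B : alg k) (U V W : Sm k).

Local Notation X1 := (X1 lam1 lam2 lam3).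
Local Notation cubic := (cubic lam1 lam2 lam3).

(* [cubic x = lam ^+ 2 + x * cubic_quotient x] *)
Definition cubic_quotient A (x : A) : A :=
  x ^+ 2 - alg_in A (lam1 + lam2 + lam3) * x
  + alg_in A (lam1 * lam2 + lam1 * lam3 + lam2 * lam3).

(* Substituting [s = lam + x * r] in [s ^+ 2 = cubic x] and dividing by [x]. *)
Definition root_eqn A (r x : A) : A :=
  alg_in A (2 * lam) * r + x * r ^+ 2 - cubic_quotient x.

(** [(lam + x * r) ^+ 2 - cubic x] equals [x * root_eqn r x]. *)
Lemma root_eqnE A (r x : A) :
  root_eqn r x = 0 -> (alg_in A lam + x * r) ^+ 2 = cubic x.
Proof.
move=> rx; have L : alg_in A lam ^+ 2 = - (alg_in A lam1 * alg_in A lam2 * alg_in A lam3).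
  by rewrite -rmorphXn lamP rmorphN !rmorphM.
have -> : (alg_in A lam + x * r) ^+ 2
    = alg_in A lam ^+ 2 + x * cubic_quotient x + x * root_eqn r x.
  by rewrite /root_eqn rmorphM rmorph_nat; ring.
by rewrite rx L /cubic /cubic_quotient !rmorphD !rmorphM; ring.
Qed.

Lemma root_eqn_nat A B (f : algHom A B) (r x : A) :
  root_eqn (f r) (f x) = f (root_eqn r x).
Proof.
by rewrite /root_eqn /cubic_quotient !(rmorphB, rmorphD, rmorphM, rmorphXn) !homP.
Qed.

Lemma alg_in_half A : alg_in A 2^-1 * 2 = 1.
Proof. by rewrite -(rmorph_nat (alg_in A)) -rmorphM mulVf // rmorph1. Qed.

(* Newton's method: [root_eqn] has derivative [2 * (lam + x * r)] in [r]. *)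
Lemma root_eqn_lift A B (p : algHom A B) (x : A) (b v : B) : square_zero_ext p ->
  root_eqn b (p x) = 0 -> v * (alg_in B lam + p x * b) = 1 ->
  exists! a, p a = b /\ root_eqn a x = 0.
Proof.
move=> [psurj p0] bx vb; have [[a ab] [w wv]] := (psurj b, psurj v).
set s := fun a => alg_in A lam + x * a.
have sP : p (w * s a - 1) = 0.
  by rewrite rmorphB rmorphM rmorph1 rmorphD rmorphM homP ab wv vb subrr.
have eP a' d : root_eqn (a' + d) x = root_eqn a' x + 2 * s a' * d + x * (d * d).
  by rewrite /root_eqn /s rmorphM rmorph_nat; ring.
have rP : p (root_eqn a x) = 0 by rewrite -root_eqn_nat ab.
set n := root_eqn a x in rP.
have n2 : n * n = 0 by apply: p0.
have mn : (w * s a - 1) * n = 0 by apply: p0.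
(* One Newton step from [a], with [w] as approximate inverse of [s a]. *)
have cP : p (a - alg_in A 2^-1 * w * n) = b by rewrite rmorphB rmorphM rP mulr0 subr0.
have cx : root_eqn (a - alg_in A 2^-1 * w * n) x = 0.
  rewrite eP -/n.
  transitivity (n - (alg_in A 2^-1 * 2) * (w * s a) * n
      + x * (alg_in A 2^-1 * w) ^+ 2 * (n * n)); first by ring.
  rewrite alg_in_half n2; transitivity (- ((w * s a - 1) * n)); first by ring.
  by rewrite mn oppr0.
move: (a - _) cP cx => {sP rP n n2 mn ab}c cb cx.
exists c; split=> // a' [a'b a'x].
have sP : p (w * s c - 1) = 0.
  by rewrite rmorphB rmorphM rmorph1 rmorphD rmorphM homP cb wv vb subrr.
have pe : p (a' - c) = 0 by rewrite rmorphB a'b cb subrr.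
have ee := p0 _ _ pe pe; have me := p0 _ _ sP pe.
(* Two roots over [b] differ by an element of square zero, so the expansion at [c] leaves
   [2 * s c * (a' - c) = 0], where [2 * s c] is invertible up to the kernel of [p]. *)
have := eP c (a' - c); rewrite addrC subrK a'x cx add0r ee mulr0 addr0 => es.
apply/eqP; rewrite eq_sym -subr_eq0; apply/eqP.
rewrite -[LHS]mul1r -(alg_in_half A).
transitivity (alg_in A 2^-1 * w * (2 * s c * (a' - c))
   - alg_in A 2^-1 * 2 * ((w * s c - 1) * (a' - c))); first by ring.
by rewrite -es me !mulr0 subrr.
Qed.

(** At [x = 0] the equation is linear in [r] with slope [2 * lam]. *)
Lemma root_eqn_root0 A (x : A) : x = 0 ->
  root_eqn (alg_in A ((lam1 * lam2 + lam1 * lam3 + lam2 * lam3) / (2 * lam))) x = 0.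
Proof.
move=> ->; rewrite /root_eqn /cubic_quotient mul0r addr0 expr0n mulr0 subr0 add0r.
by rewrite -rmorphM mulrC divfK ?subrr // mulf_neq0.
Qed.

(* The two charts of a Nisnevich neighbourhood of the divisor [x = 0]: its
   complement, and the part of the double cover [s ^+ 2 = cubic x], [s != 0],
   where [s = lam] along the divisor. *)
Section Charts.
Variables (U : Sm k) (x : knat U (A1 k)).

Lemma root_locus_subproof A B (f : algHom A B) (u : kprod (A1 k) U A) :
  root_eqn (f u.1) (x B (pmap f u.2)) = f (root_eqn u.1 (x A u.2)).
Proof. by rewrite natP root_eqn_nat. Qed.

Definition root_locus_eqn : knat (kprod (A1 k) U) (A1 k) :=
  @KNat k (kprod (A1 k) U) (A1 k) (fun A u => root_eqn u.1 (x A u.2))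
    root_locus_subproof.

Lemma root_subproof A B (f : algHom A B) (z : zero_locus root_locus_eqn A) :
  alg_in B lam + x B (sval (pmap f z)).2 * (sval (pmap f z)).1
  = f (alg_in A lam + x A (sval z).2 * (sval z).1).
Proof. by rewrite rmorphD rmorphM homP /= natP. Qed.

Definition root_fun : knat (zero_locus root_locus_eqn) (A1 k) :=
  @KNat k (zero_locus root_locus_eqn) (A1 k)
    (fun A z => alg_in A lam + x A (sval z).2 * (sval z).1) root_subproof.

Definition unit_chart_proj : knat (zero_locus (inverse_eqn x)) U :=
  hypersurface_proj (inverse_eqn x).

Definition root_chart_proj : knat (zero_locus (inverse_eqn root_fun)) U :=
  compNat (hypersurface_proj root_locus_eqn) (hypersurface_proj (inverse_eqn root_fun)).

Lemma unit_chart_etale : formally_etale unit_chart_proj.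
Proof. exact: inverse_etale. Qed.

Lemma root_chart_etale : formally_etale root_chart_proj.
Proof.
apply: formally_etale_comp; last exact: inverse_etale.
move=> A B p pP [[v w] /= /eqP vw] u wu; apply: hypersurface_lift => // w0.
have px : p (x A u) = x B (pmap p u) by rewrite natP.
(* The coordinate [v] of the chart is the inverse of [lam + x * r] that makes the root simple. *)
apply: (root_eqn_lift (x := x A u) (v := v) pP); rewrite px //.
by apply/eqP; rewrite -wu -subr_eq0.
Qed.

Definition unit_chart : Sm k :=
  MkSm (zero_locus_scheme (inverse_eqn x) (A1_prod_scheme (sm_scheme U)))
    (formally_etale_smooth unit_chart_etale (@sm_smooth k U)).

Definition root_chart : Sm k :=
  MkSm (zero_locus_scheme (inverse_eqn root_fun) (A1_prod_scheme
      (zero_locus_scheme root_locus_eqn (A1_prod_scheme (sm_scheme U)))))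
    (formally_etale_smooth root_chart_etale (@sm_smooth k U)).

Definition chart (b : bool) : Sm k := if b then unit_chart else root_chart.

Definition chart_proj b : knat (chart b) U :=
  match b with true => unit_chart_proj | false => root_chart_proj end.

(** A point over a field with [x != 0] lifts by means of [1 / x]. One with [x = 0] lifts by the root
    of the linear equation in [r], with [s = lam]. Neither requires a field extension, hence the
    cover is completely decomposed. *)
Lemma charts_cover : nisnevich_cover chart_proj.
Proof.
split=> [[]|K iota u]; [exact: unit_chart_etale|exact: root_chart_etale|].
have [xu|xu] := eqVneq (x (Alg iota) u : K) 0; last first.
  have h : (inverse_eqn x) (Alg iota) ((x (Alg iota) u : K)^-1, u) = 0.
    by rewrite /= mulVf // subrr.
  by exists true, (zero_locus_point h).
have h : root_locus_eqn (Alg iota) (_, u) = 0 := @root_eqn_root0 (Alg iota) _ xu.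
have h' : inverse_eqn root_fun (Alg iota)
   (alg_in (Alg iota) lam^-1, zero_locus_point h) = 0.
  rewrite /= [x _ _]xu mul0r addr0 -rmorphM mulVf // rmorph1 subrr //.
by exists false, (zero_locus_point h').
Qed.

End Charts.

(** * Maps into [X_1] and into its pullbacks along [psi_1] *)

Lemma X1_knat (W : kfun k) (a b c : knat W (A1 k)) :
  (forall A w, c A w ^+ 2 = a A w ^+ 2 * cubic (b A w)) ->
  (forall A w, exists u v, u * a A w + v * b A w = 1) ->
  exists p : knat W X1, forall A w,
    [/\ px0 (p A w) = a A w, px1 (p A w) = b A w & py1 (p A w) = c A w].
Proof.
move=> eq ne0.
have ne A (w : W A) : exists u v t, u * a A w + v * b A w + t * c A w = 1.
  by have [u [v e]] := ne0 A w; exists u, v, 0; rewrite mul0r addr0.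
pose p A (w : W A) : X1 A := X1Pt (eq A w) (ne A w).
have nt A B (f : algHom A B) (w : W A) : p B (pmap f w) = pmap f (p A w).
  by apply: X1_pt_eq; rewrite /= natP.
by exists (KNat nt).
Qed.

Section Pullback.
(** [Z] is the fibre product of [x : Y -> A^1] and [psi_1 : X_1 -> A^1]. Stating this on points
    covers both [X_1] over [X_0 = A^1] and the later stages of the tower. *)
Variables (Y Z : kfun k) (x : knat Y (A1 k)) (pi : knat Z Y) (q : knat Z X1).
Hypotheses (pbC : forall A z, px1 (q A z) = x A (pi A z))
  (pb : forall A (y : Y A) (p : X1 A), px1 p = x A y ->
     exists! z, pi A z = y /\ q A z = p).

Lemma pb_knat (W : kfun k) (y : knat W Y) (p : knat W X1) :
  (forall A w, px1 (p A w) = x A (y A w)) ->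
  exists z : knat W Z, compNat pi z = y /\ compNat q z = p.
Proof.
move=> py; pose z A w := sval (cid (pb (py A w))).
have zP A w : pi A (z A w) = y A w /\ q A (z A w) = p A w.
  by have [] := svalP (cid (pb (py A w))).
have zU A w t : pi A t = y A w -> q A t = p A w -> z A w = t.
  by move=> ty tp; have [_ zU] := svalP (cid (pb (py A w))); apply: zU.
have nt A B (f : algHom A B) (w : W A) : z B (pmap f w) = pmap f (z A w).
  by have [zy zp] := zP A w; apply: zU; rewrite !natP ?zy ?zp.
exists (KNat nt).
by split; apply: knat_eq => A w; have [] := zP A w.
Qed.

Lemma pb_inj (W : kfun k) (z z' : knat W Z) :
  compNat pi z = compNat pi z' -> compNat q z = compNat q z' -> z = z'.
Proof.
move=> piz qz; apply: knat_eq => A w.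
have [t [_ tU]] := pb (pbC (z A w)).
rewrite -(tU (z A w)) //; apply: tU; split.
  exact: (congr1 (fun f : knat W Y => f A w) (esym piz)).
exact: (congr1 (fun f : knat W X1 => f A w) (esym qz)).
Qed.

(* Points [(u, x, s * u)] with the same [x] and [s] are joined by moving [u]. *)
Lemma scale_homotopic U (z0 z1 : knat U Z) (s : knat U (A1 k)) :
  compNat pi z0 = compNat pi z1 ->
  (forall A u, let p0 := q A (z0 A u) in let p1 := q A (z1 A u) in
     [/\ py1 p0 = s A u * px0 p0, py1 p1 = s A u * px0 p1,
         s A u ^+ 2 = cubic (px1 p0), exists a b, a * px0 p0 + b * px1 p0 = 1
       & exists d, px0 p1 = px0 p0 + d * px1 p0]) ->
  @A1_homotopic k (points_sheaf Z) U z0 z1.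
Proof.
move=> piz zP.
have px1z A (u : U A) : px1 (q A (z1 A u)) = px1 (q A (z0 A u)).
  by rewrite !pbC; congr (x A _); exact: (congr1 (fun f : knat U Y => f A u) (esym piz)).
(* The first coordinate is interpolated linearly and the third is kept equal to [s] times it. *)
pose af A (w : A1x U A) : A1 k A :=
  (1 - w.1) * px0 (q A (z0 A w.2)) + w.1 * px0 (q A (z1 A w.2)).
have ant A B (f : algHom A B) w : af B (pmap f w) = f (af A w).
  by rewrite /af /= !natP rmorphD !rmorphM rmorphB rmorph1.
pose bf A (w : A1x U A) : A1 k A := px1 (q A (z0 A w.2)).
have bnt A B (f : algHom A B) w : bf B (pmap f w) = f (bf A w).
  by rewrite /bf /= !natP.
pose cf A (w : A1x U A) : A1 k A := s A w.2 * af A w.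
have cnt A B (f : algHom A B) w : cf B (pmap f w) = f (cf A w).
  by rewrite /cf ant rmorphM /= natP.
have [A [t u]|A [t u]|p pE] := X1_knat (a := KNat ant) (b := KNat bnt) (c := KNat cnt).
- by rewrite /= /cf exprMn mulrC /=; have [_ _ ->] := zP A u.
(* The interpolated coordinate is [px0 p0 + t * d * x]; the extra multiple of [x] is absorbed into
   the coefficient of [x]. *)
- have [_ _ _ [a [b ab]] [d dE]] := zP A u; exists a, (b - a * t * d).
  by rewrite -[RHS]ab /= /af /= dE /bf /=; ring.
have [A [t u]|h [hy hp]] := @pb_knat (A1x U)
   (@KNat k (A1x U) Y (fun A w => pi A (z0 A w.2))
     (fun A B f w => natP (compNat pi z0) f w.2)) p.
  by have [_ -> _] := pE A (t, u); rewrite /= /bf pbC.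
have hyE A w : pi A (h A w) = pi A (z0 A w.2).
  exact: (congr1 (fun f : knat (A1x U) Y => f A w) hy).
have hpE A w : q A (h A w) = p A w.
  exact: (congr1 (fun f : knat (A1x U) X1 => f A w) hp).
exists h; split; apply: pb_inj; apply: knat_eq => A u; rewrite /= ?hyE ?hpE //=.
- have [e0 e1 e2] := pE A (alg_in A 0, u); have [f0 _ _ _ _] := zP A u.
  have aE : af A (alg_in A 0, u) = px0 (q A (z0 A u)).
    by rewrite /af /= rmorph0 subr0 mul1r mul0r addr0.
  by apply: X1_pt_eq; rewrite ?e0 ?e1 ?e2 //= /cf aE f0.
- exact: (congr1 (fun f : knat U Y => f A u) piz).
- have [e0 e1 e2] := pE A (alg_in A 1, u); have [_ f1 _ _ _] := zP A u.
  have aE : af A (alg_in A 1, u) = px0 (q A (z1 A u)).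
    by rewrite /af /= rmorph1 subrr mul0r mul1r add0r.
  by apply: X1_pt_eq; rewrite ?e0 ?e1 ?e2 //= /cf ?aE ?f1 // px1z.
Qed.

(* The lifts of [y] that are glued to a section of [S_ Z]: [(0, x, 0)] where [x]
   is invertible, and [(1, x, s)] near [x = 0], with [s] the square root of
   [cubic x] that equals [lam] there. *)
Definition good_lift U (y : knat U Y) (z : knat U Z) :=
  compNat pi z = y /\
  ((forall A u, let p := q A (z A u) in
      [/\ px0 p = 0, py1 p = 0 & exists i, i * px1 p = 1]) \/
   exists i : knat U (A1 k), forall A u, let p := q A (z A u) in
      [/\ px0 p = 1, i A u * py1 p = 1 & exists r, py1 p = alg_in A lam + px1 p * r]).

Lemma good_lift_res U V (g : knat V U) (y : knat U Y) (z : knat U Z) :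
  good_lift y z -> good_lift (compNat y g) (compNat z g).
Proof.
move=> [<- zP]; split; first by rewrite compNatA.
case: zP => [zP|[i zP]]; [left|right; exists (compNat i g)] => A u; exact: zP.
Qed.

(** The second kind of lift makes [x] invertible, so the first coordinates 1 and 0 differ by a
    multiple of [x]; [(u, x, s * u)] then joins the two lifts. *)
Lemma good_lift_uniq01 U (z z' : knat U Z) :
  compNat pi z = compNat pi z' ->
  (exists i : knat U (A1 k), forall A u, let p := q A (z A u) in
      [/\ px0 p = 1, i A u * py1 p = 1 & exists r, py1 p = alg_in A lam + px1 p * r]) ->
  (forall A u, let p := q A (z' A u) in
      [/\ px0 p = 0, py1 p = 0 & exists i, i * px1 p = 1]) ->
  @A1_homotopic k (points_sheaf Z) U z z'.
Proof.
move=> zz' [i zP] z'P.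
pose sf A (u : U A) : A1 k A := py1 (q A (z A u)).
have snt A B (f : algHom A B) u : sf B (pmap f u) = f (sf A u).
  by rewrite /sf !natP.
apply: (@scale_homotopic _ _ _ (KNat snt)) => // A u /=.
have [a0 _ _] := zP A u; have [b0 b1 [j jx]] := z'P A u.
have xx : px1 (q A (z' A u)) = px1 (q A (z A u)).
  by rewrite !pbC; congr (x A _); exact: (congr1 (fun f : knat U Y => f A u) (esym zz')).
rewrite a0 b0 b1 /sf; split; rewrite ?mulr1 ?mulr0 //.
- by rewrite X1_eq a0 expr1n mul1r.
- by exists 1, 0; rewrite mul0r addr0 mulr1.
- by exists (- j); rewrite mulNr -xx jx subrr.
Qed.

(** Two lifts of the form [(0, x, 0)] coincide, and the mixed case is [good_lift_uniq01]. Two lifts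
    [(1, x, s)] and [(1, x, s')] are joined by a chain of two homotopies through
    [(e, x, s * e) = (e, x, s' * e)], with [e] as below. *)
Lemma good_lift_uniq U (y : knat U Y) (z z' : knat U Z) :
  good_lift y z -> good_lift y z' -> @A1_equiv k (points_sheaf Z) U z z'.
Proof.
move=> [zy zP] [z'y z'P]; have zz' : compNat pi z = compNat pi z' by rewrite zy.
have xx A (u : U A) : px1 (q A (z' A u)) = px1 (q A (z A u)).
  by rewrite !pbC; congr (x A _); exact: (congr1 (fun f : knat U Y => f A u) (esym zz')).
case: zP z'P => [z0|z1] [z'0|z'1].
- apply: A1_equiv_eq; apply: pb_inj => //; apply: knat_eq => A u.
  have [a0 a1 _] := z0 A u; have [b0 b1 _] := z'0 A u.
  by apply: X1_pt_eq; rewrite /= ?xx ?a0 ?a1 ?b0 ?b1.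
- by apply: rst_sym; apply: rst_step; apply: good_lift_uniq01.
- by apply: rst_step; apply: good_lift_uniq01.
move: z1 z'1 => [i zP] [i' z'P].
(* [s' / s] is a square root of 1 equal to 1 along [x = 0], so that
   [e = (1 + s' / s) / 2] is an idempotent with [e * s = e * s'] and
   [1 - e] in the ideal of [x]. *)
pose sf A (u : U A) : A1 k A := py1 (q A (z A u)).
have snt A B (f : algHom A B) u : sf B (pmap f u) = f (sf A u).
  by rewrite /sf !natP.
pose sf' A (u : U A) : A1 k A := py1 (q A (z' A u)).
have snt' A B (f : algHom A B) u : sf' B (pmap f u) = f (sf' A u).
  by rewrite /sf' !natP.
pose ef A (u : U A) : A1 k A := alg_in A 2^-1 * (1 + sf' A u * i A u).
have ent A B (f : algHom A B) u : ef B (pmap f u) = f (ef A u).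
  by rewrite /ef snt' rmorphM rmorphD rmorph1 rmorphM homP natP.
pose bf A (u : U A) : A1 k A := px1 (q A (z A u)).
have bnt A B (f : algHom A B) u : bf B (pmap f u) = f (bf A u).
  by rewrite /bf !natP.
pose cf A (u : U A) : A1 k A := sf A u * ef A u.
have cnt A B (f : algHom A B) u : cf B (pmap f u) = f (cf A u).
  by rewrite /cf snt ent rmorphM.
have s2 A u : sf A u ^+ 2 = cubic (bf A u).
  by have [a0 _ _] := zP A u; rewrite X1_eq a0 expr1n mul1r.
have s'2 A u : sf' A u ^+ 2 = cubic (bf A u).
  by have [a0 _ _] := z'P A u; rewrite X1_eq a0 expr1n mul1r xx.
(* Both sides equal [(s + s') / 2], since [s] and [s'] have the same square and [i] inverts [s]. *)
have ses' A u : sf A u * ef A u = sf' A u * ef A u.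
  have [_ iz _] := zP A u; rewrite -/(sf A u) in iz.
  transitivity (alg_in A 2^-1 * (sf A u + sf' A u * (i A u * sf A u))).
    by rewrite /ef; ring.
  transitivity (alg_in A 2^-1 * (sf' A u + sf' A u ^+ 2 * i A u)).
    2: by rewrite /ef; ring.
  rewrite s'2 -s2.
  transitivity (alg_in A 2^-1 * (sf' A u + sf A u * (i A u * sf A u))).
    2: by ring.
  by rewrite iz !mulr1 addrC.
have e1 A u : exists d, ef A u = 1 + d * bf A u.
  have [_ iz [r rz]] := zP A u; have [_ _ [r' rz']] := z'P A u.
  rewrite -/(sf A u) in iz rz; rewrite -/(sf' A u) xx in rz'.
  (* Indeed [e - 1 = i * (s' - s) / 2], and [s' - s = x * (r' - r)] because both roots are [lam]
     along [x = 0]. *)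
  exists (alg_in A 2^-1 * i A u * (r' - r)).
  transitivity (alg_in A 2^-1 * (i A u * sf A u + sf A u * i A u
      + i A u * (sf' A u - sf A u))); first by rewrite /ef iz; ring.
  rewrite [sf A u * _]mulrC iz rz rz' -/(bf A u).
  transitivity (alg_in A 2^-1 * 2 + alg_in A 2^-1 * i A u * (r' - r) * bf A u).
    ring.
  by rewrite alg_in_half.
have [A u|A u|p pE] := X1_knat (a := KNat ent) (b := KNat bnt) (c := KNat cnt).
- by rewrite /= /cf exprMn s2 mulrC.
- have [d dE] := e1 A u; exists 1, (- d).
  by rewrite /= dE; ring.
have [A u|m [my mp]] := @pb_knat U y p.
  have [_ -> _] := pE A u; rewrite /= /bf pbC; congr (x A _).
  exact: (congr1 (fun f : knat U Y => f A u) zy).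
have mE A u : [/\ px0 (q A (m A u)) = ef A u, px1 (q A (m A u)) = bf A u
    & py1 (q A (m A u)) = cf A u].
  have -> : q A (m A u) = p A u by exact: (congr1 (fun f : knat U X1 => f A u) mp).
  exact: pE.
apply: (@rst_trans _ _ _ m); apply: rst_step.
- apply: (@scale_homotopic _ _ _ (KNat snt)) => [|A u /=]; first by rewrite my.
  have [a0 _ _] := zP A u; have [m0 m1 m2] := mE A u; have [d dE] := e1 A u.
  rewrite a0 m0 m2; split; rewrite ?mulr1 //; first exact: s2.
  + by exists 1, 0; rewrite mul0r addr0 mulr1.
  + by exists d.
- apply: (@scale_homotopic _ _ _ (KNat snt')) => [|A u /=]; first by rewrite my.
  have [a0 _ _] := z'P A u; have [m0 m1 m2] := mE A u; have [d dE] := e1 A u.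
  rewrite a0 m0 m1 m2; split; rewrite ?mulr1 //; first exact: ses'.
  + exact: s'2.
  + by exists 1, (- d); rewrite dE; ring.
  + by exists (- d); rewrite dE; ring.
Qed.

(** The charts of the function [x] on [U] do: the lift is [(0, x, 0)] on the first and [(1, x, s)]
    with [s = lam + x * r] on the second, whose extra coordinate [v] inverts [s]. *)
Lemma good_lift_local U (y : knat U Y) : exists R : sieve U, covering R /\
  forall V (f : knat V U), R V f -> exists z, good_lift (compNat y f) z.
Proof.
have resP (V W : Sm k) (f : knat V U) (g : knat W V) :
    (exists z, good_lift (compNat y f) z) ->
    exists z, good_lift (compNat y (compNat f g)) z.
  by move=> [z zL]; exists (compNat z g); rewrite compNatA; apply: good_lift_res.
exists (@Sieve k U (fun V f => exists z, good_lift (compNat y f) z) resP).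
split=> //; apply: (covering_nis (charts_cover (compNat x y))) => b /=.
pose X : knat (chart (compNat x y) b) (A1 k) :=
  compNat x (compNat y (chart_proj (compNat x y) b)).
pose one : knat (chart (compNat x y) b) (A1 k) :=
  @KNat k (chart (compNat x y) b) (A1 k) (fun A _ => 1) (fun A B f _ => esym (rmorph1 f)).
pose zero : knat (chart (compNat x y) b) (A1 k) :=
  @KNat k (chart (compNat x y) b) (A1 k) (fun A _ => 0) (fun A B f _ => esym (rmorph0 f)).
case: b @X @one @zero => X one zero.
- have xV A (w : unit_chart (compNat x y) A) : (sval w).1 * X A w = 1.
    by apply/eqP; rewrite -subr_eq0; apply/eqP; exact: (svalP w).
  have [A w|A w|p pE] := X1_knat (a := zero) (b := X) (c := zero).
  + by rewrite /= expr0n mul0r.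
  + by exists 0, (sval w).1; rewrite xV mulr0 add0r.
  have [A w|z [zy zp]] := @pb_knat _ (compNat y (chart_proj (compNat x y) true)) p.
    by have [_ -> _] := pE A w.
  exists z; split=> //; left=> A w.
  have -> : q A (z A w) = p A w by rewrite -zp.
  have [e0 e1 e2] := pE A w; rewrite /= e0 e1 e2; split=> //.
  by exists (sval w).1; apply: xV.
pose s : knat (root_chart (compNat x y)) (A1 k) :=
  compNat (root_fun (compNat x y))
    (hypersurface_proj (inverse_eqn (root_fun (compNat x y)))).
pose v : knat (root_chart (compNat x y)) (A1 k) :=
  @KNat k (root_chart (compNat x y)) (A1 k) (fun A w => (sval w).1)
    (fun A B f w => erefl).
have vs A w : v A w * s A w = 1.
  by apply/eqP; rewrite -subr_eq0; apply/eqP; exact: (svalP w).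
have [A w|A w|p pE] := X1_knat (a := one) (b := X) (c := s).
- by rewrite /= expr1n mul1r; apply: root_eqnE; exact: (svalP (sval w).2).
- by exists 1, 0; rewrite mul0r addr0 mul1r.
have [A w|z [zy zp]] := @pb_knat _ (compNat y (chart_proj (compNat x y) false)) p.
  by have [_ -> _] := pE A w.
exists z; split=> //; right; exists v => A w.
have -> : q A (z A w) = p A w by rewrite -zp.
have [e0 e1 e2] := pE A w; rewrite /= e0 e1 e2; split=> //; first exact: vs.
by exists (sval (sval w).2).1.
Qed.

(** Glueing gives [sigma : Y -> S(Z)] with [sigma y0 = [z0]_1] and [sigma y1 = [z1]_1]. The homotopy
    is transported by [S^j(sigma)] and then by the comparison map from [S^j(S(Z))] to
    [S^(j+1)(Z)]. *)
Lemma S_iter_pullback j (y0 y1 : knat (SpecBase k) Y) (z0 z1 : knat (SpecBase k) Z) :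
  good_lift y0 z0 -> good_lift y1 z1 ->
  @A1_homotopic k (S_iter j (points_sheaf Y)) (SpecBase k)
    (@to_S_iter k (points_sheaf Y) (SpecBase k) j y0)
    (@to_S_iter k (points_sheaf Y) (SpecBase k) j y1) ->
  @A1_homotopic k (S_iter j.+1 (points_sheaf Z)) (SpecBase k)
    (@to_S_iter k (points_sheaf Z) (SpecBase k) j.+1 z0)
    (@to_S_iter k (points_sheaf Z) (SpecBase k) j.+1 z1).
Proof.
move=> L0 L1.
have [s sE] := @exists_glue k (points_sheaf Y) (points_sheaf Z) good_lift
  good_lift_res good_lift_uniq good_lift_local.
have [s' s'E] := S_iter_pmor j s; have [t tE] := S_iter_S j (points_sheaf Z).
move=> /(A1_homotopic_pmor s') /(A1_homotopic_pmor t).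
by rewrite !s'E (sE _ _ _ L0) (sE _ _ _ L1) !tE.
Qed.

End Pullback.

(** * The tower [X_n] and the induction *)

Local Notation Xn := (Xn lam1 lam2 lam3).

Definition first_factor n : knat (Xn n.+1) X1 :=
  @KNat k (Xn n.+1) X1 (fun A z => sval z ord0) (fun A B f z => erefl).

(** The bottom stage, where [Y = X_0 = A^1] and [x] is the identity. *)
Lemma first_factor_pullback A (y : A1 k A) (p : X1 A) : px1 p = y ->
  exists! z, compNat (psi1 _ _ _) (first_factor 0) A z = y /\ first_factor 0 A z = p.
Proof.
move=> py; have [z [zp zU]] := X1_chain p.
by exists z; split=> [|z' [_ /zU]//]; rewrite /= zp.
Qed.

(** Put [p] in front of the chain [y]; the only new chaining condition is the hypothesis. *)
Lemma psin_pullback n A (y : Xn n.+1 A) (p : X1 A) :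
  px1 p = compNat (phi1 _ _ _) (first_factor n) A y ->
  exists! z, psin _ _ _ n.+1 A z = y /\ first_factor n.+1 A z = p.
Proof.
move=> py; pose c (i : 'I_n.+2) := if unlift ord0 i is Some j then sval y j else p.
have cS (j : 'I_n.+1) : c (lift ord0 j) = sval y j by rewrite /c liftK.
have c0 : c ord0 = p by rewrite /c unlift_none.
have cP : chainable c.
  move=> i j; case: (unliftP ord0 i) => [i'|] ->;
    case: (unliftP ord0 j) => [j'|] -> //; rewrite ?c0 ?cS ?lift0.
    by move=> [ij]; apply: (svalP y).
  by move=> [j0]; have -> : j' = ord0 by [apply: val_inj].
exists (exist _ c cP); split=> [|z [zy zp]].
  by split; [apply: Xn_pt_eq => i /=; rewrite cS | rewrite /= c0].
apply: Xn_pt_eq => i /=; case: (unliftP ord0 i) => [j|] ->.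
  by rewrite cS -zy.
by rewrite c0 -zp.
Qed.

(** The first factor [(1, 0, lam)] has the form [(1, x, s)] with [s = lam], hence [r = 0]. *)
Lemma alpha_good_lift (Y : kfun k) n (pi : knat (Xn n.+1) Y) y :
  pi _ (alpha lamP n.+1) = y ->
  good_lift pi (first_factor n) (pt_section y) (pt_section (alpha lamP n.+1)).
Proof.
move=> <-; split; first by apply: knat_eq => A s; rewrite /= natP.
right; exists (@KNat k (SpecBase k) (A1 k) (fun A s => s lam^-1) (fun A B f s => erefl)).
move=> A s /=; rewrite rmorph1 -rmorphM mulVf // rmorph1; split=> //.
by exists 0; rewrite mulr0 addr0 -(homP s).
Qed.

(** The first factor [(0, 1, 0)] has the form [(0, x, 0)] with [x = 1] invertible. *)
Lemma beta_good_lift (Y : kfun k) n (pi : knat (Xn n.+1) Y) y :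
  pi _ (beta lamP n.+1) = y ->
  good_lift pi (first_factor n) (pt_section y) (pt_section (beta lamP n.+1)).
Proof.
move=> <-; split; first by apply: knat_eq => A s; rewrite /= natP.
left=> A s /=; rewrite rmorph0 rmorph1; split=> //.
by exists 1; rewrite mulr1.
Qed.

Lemma psin_alpha n : psin _ _ _ n _ (alpha lamP n.+1) = beta lamP n.
Proof. by apply: Xn_pt_eq => i /=; case: odd. Qed.

Lemma psin_beta n : psin _ _ _ n _ (beta lamP n.+1) = alpha lamP n.
Proof. by apply: Xn_pt_eq => i /=; case: odd. Qed.

Lemma A1_homotopic_01 : @A1_homotopic k (points_sheaf (A1 k)) (SpecBase k)
  (@pt_section k (A1 k) 0) (@pt_section k (A1 k) 1).
Proof.
exists (@KNat k (A1x (SpecBase k)) (A1 k) (fun A w => w.1) (fun A B f w => erefl)).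
by split; apply: knat_eq => A s /=; rewrite ?rmorph0 ?rmorph1.
Qed.

Lemma alpha_beta_homotopic n :
  @A1_homotopic k (S_iter n.+1 (points_sheaf (Xn n.+1))) (SpecBase k)
    (to_S_iter n.+1 (pt_section (alpha lamP n.+1)))
    (to_S_iter n.+1 (pt_section (beta lamP n.+1))).
Proof.
elim: n => [|n IH].
  (* [alpha_1] and [beta_1] lie over the points 0 and 1 of [A^1]. *)
  apply: (@S_iter_pullback _ _ idNat _ (first_factor 0) _ first_factor_pullback 0
    (@pt_section k (A1 k) 0) (@pt_section k (A1 k) 1)) => //.
  - exact: alpha_good_lift.
  - exact: beta_good_lift.
  - exact: A1_homotopic_01.
apply: (@S_iter_pullback _ _ _ _ (first_factor n.+1) _ (@psin_pullback n) n.+1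
  (pt_section (beta lamP n.+1)) (pt_section (alpha lamP n.+1))).
(* The square commutes by the chaining condition between the first two factors. *)
- by move=> A z; apply: (svalP z ord0 (lift ord0 ord0)).
- by apply: alpha_good_lift; apply: psin_alpha.
- by apply: beta_good_lift; apply: psin_beta.
(* Dropping the first factor exchanges the two alternating sequences, so the induction hypothesis is
   used backwards. *)
- exact: A1_homotopic_sym.
Qed.

End DoubleCover.

Theorem theorem3p10 (R : realType) (lam1 lam2 lam3 lam : R[i])
    (lam1_neq0 : lam1 != 0) (lam2_neq0 : lam2 != 0) (lam3_neq0 : lam3 != 0)
    (lamP : lam ^+ 2 = - (lam1 * lam2 * lam3)) (n : nat) (n_ge1 : (1 <= n)%N) :
  @A1_homotopic R[i] (S_iter n (points_sheaf (Xn lam1 lam2 lam3 n))) (SpecBase R[i])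
    (to_S_iter n (pt_section (alpha lamP n)))
    (to_S_iter n (pt_section (beta lamP n))).
Proof.
case: n n_ge1 => // n _; apply: alpha_beta_homotopic.
- by rewrite Num.Theory.pnatr_eq0.
(* All three roots of the cubic are nonzero, hence so is [lam]. *)
- have : lam ^+ 2 != 0 by rewrite lamP oppr_eq0 !mulf_neq0.
  by rewrite expf_eq0.
Qed.
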